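(* Assume that $F$ is strictly pseudo-monotone on $X$. Suppose that the problem assumptions (P1)–(P2), the sampling assumptions (R1)–(R4) and the stepsize assumptions (G1)–(G2) listed in the context hold, and let $\{x_k\}$ be generated by the randomized block stochastic mirror-prox (B-SMP) algorithm described in the context. Then $x_k$ converges almost surely to the unique solution $x^*$ of the variational inequality $\mathrm{VI}(X,F)$.
   Context: **Problem.** Let $d,n_1,\dots,n_d\ge 1$, $n=\sum_{i=1}^d n_i$, and write $x\in\mathbb R^n$ as $x=(x^1;\dots;x^d)$ with $x^i\in\mathbb R^{n_i}$; $x^{-i}$ denotes the collection of blocks $x^j$, $j\ne i$, and $x=(x^i;x^{-i})$. $\|\cdot\|_i$ is a norm on $\mathbb R^{n_i}$ with dual norm $\|x\|_{*i}=\sup_{\|y\|_i\le 1}\langle y,x\rangle$; on $\mathbb R^n$, $\langle u,v\rangle=\sum_i\langle u^i,v^i\rangle$ and $\|x\|^2=\sum_i\|x^i\|_i^2$. Let $X_i\subset\mathbb R^{n_i}$, $X=\prod_{i=1}^d X_i$, let $\xi$ be a random vector in $\mathbb R^m$, let $F(\cdot,\cdot):X\times\mathbb R^m\to\mathbb R^n$ be a random mapping with blocks $F_i(\cdot,\cdot)\in\mathbb R^{n_i}$, and let $F(x)=\mathsf E[F(x,\xi)]$ (assumed finite), with blocks $F_i(x)$. $\mathrm{VI}(X,F)$ is the problem of finding $x^*\in X$ with $\langle F(x^* ),x-x^*\rangle\ge 0$ for all $x\in X$. **Strict pseudo-monotonicity.** $F$ is strictly pseudo-monotone on $X$ if for any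 $x,y\in X$ with $x\ne y$, $\langle F(y),x-y\rangle\ge 0$ implies $\langle F(x),x-y\rangle>0$. **Prox mappings.** For each $i$, $\omega_i:X_i\to\mathbb R$ is continuously differentiable, strongly convex with parameter $\mu_{\omega_i}>0$: $\omega_i(y)\ge\omega_i(x)+\langle\nabla\omega_i(x),y-x\rangle+\frac{\mu_{\omega_i}}2\|x-y\|_i^2$ for $x,y\in X_i$, and satisfies $\omega_i(y)\le\omega_i(x)+\langle\nabla\omega_i(x),y-x\rangle+\frac{L_{\omega_i}}2\|x-y\|_i^2$ for $x,y\in X_i$. Define $D_i(x,y)=\omega_i(y)-\omega_i(x)-\langle\nabla\omega_i(x),y-x\rangle$ for $x,y\in X_i$ and $P_i(x,y)=\operatorname{argmin}_{z\in X_i}\{\langle y,z\rangle+D_i(x,z)\}$ for $x\in X_i$, $y\in\mathbb R^{n_i}$. **B-SMP algorithm.** Given a random initial point $x_0=y_0\in X$, positive stepsizes $\gamma_k$, and probabilities $p_1,\dots,p_d$ with $\sum_ip_i=1$: at each iteration $k\ge 0$ draw $i_k\in\{1,\dots,d\}$ with $\mathrm{Prob}(i_k=i)=p_i$ and realizations $\xi_k,\tilde\xi_k$ of $\xi$; set $y_{k+1}^{i_k}=P_{i_k}(x_k^{i_k},\gamma_kF_{i_k}(x_k,\tilde\xi_k))$ and $y_{k+1}^i=x_k^i$ for $i\ne i_k$; then set $x_{k+1}^{i_k}=P_{i_k}(x_k^{i_k},\gamma_kF_{i_k}(y_{k+1},\xi_k))$ and $x_{k+1}^i=x_k^i$ for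 $i\neq i_k$. **Assumptions.** (P1) Each $X_i$ is nonempty, closed, convex and bounded, with $\|x\|_i\le B_i$ for all $x\in X_i$. (P2) For each $i$ there is $L_i$ with $\|F_i(x^i;x^{-i})-F_i(y^i;x^{-i})\|_{*i}\le L_i\|x^i-y^i\|_i$ for all $x^i,y^i\in X_i$, $x^{-i}\in\prod_{j\ne i}X_j$. (R1) $\{\xi_k\}$, $\{\tilde\xi_k\}$, $\{i_k\}$ are each i.i.d. and all independent of each other (and of $x_0$). (R2) $\mathsf E[F(x,\tilde\xi_k)\mid x]=\mathsf E[F(x,\xi_k)\mid x]=F(x)$ for all $x\in X$, $k\ge0$. (R3) There are $\nu_i,\tilde\nu_i>0$ such that, for all $i$, all $k\ge 0$ and all $x\in X$, $\mathsf E[\|F_i(x,\tilde\xi_k)-F_i(x)\|_{*i}^2\mid x]\le\tilde\nu_i^2$ and $\mathsf E[\|F_i(x,\xi_k)-F_i(x)\|_{*i}^2\mid x]\le\nu_i^2$. (R4) $\mathrm{Prob}(i_k=i)=p_i>0$ for all $i$, $k$. (G1) $\gamma_k>0$ and $\sum_{k=0}^\infty\gamma_k^2<\infty$. (G2) $\sum_{k=0}^\infty\gamma_k=\infty$.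
   Formalization: The mean map F is additionally assumed continuous on X: (P2) gives Lipschitz continuity only within each block, and without joint continuity the convergence claim fails already for d = 2. *)

(* Defs.v *)
(* MathComp / MathComp-Analysis, over an abstract R : realType *)
From HB Require Import structures.
From mathcomp Require Import all_boot all_order all_algebra.
From mathcomp Require Import all_classical all_reals all_analysis.

Set Implicit Arguments.
Unset Strict Implicit.
Unset Printing Implicit Defensive.

Import Order.TTheory GRing.Theory Num.Theory.
Import numFieldNormedType.Exports.

Local Open Scope classical_set_scope.
Local Open Scope ring_scope.

(* The library puts no sigma-algebra on row vectors. *)
Notation borelV R k := (g_sigma_algebraType (@open 'rV[R]_k)).

Definition dotv (R : realType) (k : nat) (u v : 'rV[R]_k) : R :=
  \sum_(j < k) u 0 j * v 0 j.

(* An arbitrary norm on R^k; the canonical norm of 'rV[R]_k is the sup norm. *)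
Definition is_norm (R : realType) (k : nat) (N : 'rV[R]_k -> R) : Prop :=
  [/\ forall u, N u = 0 -> u = 0,
      forall (a : R) u, N (a *: u) = `|a| * N u &
      forall u v, N (u + v) <= N u + N v].

Definition dual_norm (R : realType) (k : nat) (N : 'rV[R]_k -> R)
    (u : 'rV[R]_k) : R :=
  sup [set dotv v u | v in [set v | N v <= 1]].

(* A vector x = (x^1; ...; x^d) of R^(n_1 + ... + n_d) is a row vector of
   length \sum_i n i, and submxrow x i is its block x^i. *)
Definition block_prod (R : realType) (d : nat) (n : 'I_d -> nat)
    (X : forall i, set 'rV[R]_(n i)) : set 'rV[R]_(\sum_(i < d) n i) :=
  [set x | forall i, X i (submxrow x i)].

Definition VI_solution (R : realType) (k : nat) (X : set 'rV[R]_k)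
    (F : 'rV[R]_k -> 'rV[R]_k) (x : 'rV[R]_k) : Prop :=
  X x /\ forall y, X y -> 0 <= dotv (F x) (y - x).

Definition strictly_pseudomonotone (R : realType) (k : nat)
    (X : set 'rV[R]_k) (F : 'rV[R]_k -> 'rV[R]_k) : Prop :=
  forall x y, X x -> X y -> x <> y ->
    0 <= dotv (F y) (x - y) -> 0 < dotv (F x) (x - y).

(* f is continuously differentiable on A with gradient g.  A may have empty
   interior, so differentiability is taken relatively to A; the restriction to A
   of a function that is C^1 around A satisfies this with its usual gradient.
   For A convex, dotv (g x) (y - x) with x, y in A does not depend on the
   choice of g. *)
Definition C1_on (R : realType) (k : nat) (A : set 'rV[R]_k)
    (f : 'rV[R]_k -> R) (g : 'rV[R]_k -> 'rV[R]_k) : Prop :=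
  {within A, continuous g} /\
  forall x, A x -> forall e : R, 0 < e ->
    \forall y \near within A (nbhs x),
      `|f y - f x - dotv (g x) (y - x)| <= e * `|y - x|.

Definition bregman (R : realType) (k : nat) (f : 'rV[R]_k -> R)
    (g : 'rV[R]_k -> 'rV[R]_k) (x y : 'rV[R]_k) : R :=
  f y - f x - dotv (g x) (y - x).

Definition argmin_on (R : realType) (T : Type) (A : set T) (f : T -> R) :
    set T :=
  [set z | A z /\ forall z', A z' -> f z <= f z'].

(* 0 is a junk value, used only when there is no minimizer. *)
Definition prox (R : realType) (k : nat) (A : set 'rV[R]_k)
    (f : 'rV[R]_k -> R) (g : 'rV[R]_k -> 'rV[R]_k) (x y : 'rV[R]_k) :
    'rV[R]_k :=
  xget 0 (argmin_on A (fun z => dotv y z + bregman f g x z)).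

Definition mutually_independent (d : measure_display)
    (T : measurableType d) (R : realType) (P : probability T R)
    (J : eqType) (G : J -> set (set T)) : Prop :=
  forall (s : seq J) (E : J -> set T), uniq s ->
    (forall j, j \in s -> G j (E j)) ->
    P (\bigcap_(j in [set` s]) E j) = (\prod_(j <- s) P (E j))%E.

Inductive source :=
  InitPoint | Sample of nat | SampleTilde of nat | BlockIndex of nat.
HB.instance Definition _ := gen_eqMixin source.

(* The sigma-algebra generated by x_0, xi_k, xi~_k or i_k. *)
Definition source_events (d : measure_display) (T : measurableType d)
    (R : realType) (N m b : nat) (x0 : T -> borelV R N)
    (xi xit : nat -> T -> borelV R m) (ib : nat -> T -> 'I_b) (s : source) :
    set (set T) :=
  match s with
  | InitPoint => preimage_set_system setT x0 measurable
  | Sample k => preimage_set_system setT (xi k) measurable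
  | SampleTilde k => preimage_set_system setT (xit k) measurable
  | BlockIndex k => preimage_set_system setT (ib k) setT
  end.

Definition BSMP (R : realType) (d m : nat) (n : 'I_d -> nat) (T : Type)
    (X : forall i, set 'rV[R]_(n i))
    (omega : forall i, 'rV[R]_(n i) -> R)
    (gomega : forall i, 'rV[R]_(n i) -> 'rV[R]_(n i))
    (Fs : 'rV[R]_(\sum_(i < d) n i) -> 'rV[R]_m ->
          'rV[R]_(\sum_(i < d) n i))
    (gamma : nat -> R) (xi xit : nat -> T -> 'rV[R]_m)
    (ib : nat -> T -> 'I_d)
    (x y : nat -> T -> 'rV[R]_(\sum_(i < d) n i)) : Prop :=
  (forall t, block_prod X (x 0%N t) /\ y 0%N t = x 0%N t) /\
  forall k t (i : 'I_d),
    submxrow (y k.+1 t) i =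
      (if i == ib k t then
         prox (X i) (@omega i) (@gomega i) (submxrow (x k t) i)
           (gamma k *: submxrow (Fs (x k t) (xit k t)) i)
       else submxrow (x k t) i) /\
    submxrow (x k.+1 t) i =
      (if i == ib k t then
         prox (X i) (@omega i) (@gomega i) (submxrow (x k t) i)
           (gamma k *: submxrow (Fs (y k.+1 t) (xi k t)) i)
       else submxrow (x k t) i).

(* Main.v *)
(* Let x* be the solution (unique by strict pseudo-monotonicity), V(x) the Lyapunov
   function \sum_i D_i(x^i, x*^i) / p_i and W(x) = <F x, x - x*> >= 0 the gap.  For
   every event A of the past of step k, the prox inequality for the drawn block
   gives E[V(x_{k+1}); A] + gamma_k E[W(x_k); A] <= E[V(x_k); A] + C gamma_k^2:
   the extrapolated point is within O(gamma_k |F(x_k, xi~_k)|) of x_k, so by P2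
   the extrapolation only costs a term of order gamma_k^2, while the errors of
   the oracle and of the random choice of the block have zero mean given the past.

   Summing expectations, E[W(x_k)] gets arbitrarily small at arbitrarily late
   times; as X is compact and W vanishes only at x*, so does E[V(x_k)].  A
   maximal inequality started at such a time shows that V(x_k), hence x_k - x*,
   tends to 0 almost surely; no martingale convergence theorem is needed.

   A solution exists because the sets {x | <F y, y - x> >= 0} form a KKM family
   of convex sets, whose finite intersection property follows from Klee's
   intersection theorem.  All norms are replaced by the sup norm of 'rV[R]_k. *)
Require Import Defs.
From mathcomp Require Import all_boot all_order all_algebra finmap.
From mathcomp Require Import all_classical all_reals all_analysis.
From mathcomp Require Import measurable_realfun ring lra.

Set Implicit Arguments.
Unset Strict Implicit.
Unset Printing Implicit Defensive.

Import Order.TTheory GRing.Theory Num.Theory.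
Import numFieldNormedType.Exports.

Local Open Scope classical_set_scope.
Local Open Scope ring_scope.

(** * Euclidean preliminaries *)

(** The order in which a step uses its random sources shapes the probabilistic part. The index of
    the block is averaged against quantities at [x k], which depend on the past of step [k] only;
    the sample [xis k] is averaged at the extrapolated point, which also depends on [xits k] and on
    the index. Hence two histories, [past k] and [past_extrapolation k], each independent of the
    source averaged against it. The difference of [F] between the extrapolated point and [x k] is
    correlated with both draws, so it is bounded pathwise and never averaged.

    Integrals over events of the past replace conditional expectations. This suffices for the
    maximal inequality, because not having crossed a level so far is such an event.

    Continuity of [F] enters three times: it turns a point of all the sets of the KKM family into a
    solution, it bounds [F] on the compact feasible set, so that variance bounds give second moment
    bounds, and it gives the gap a positive minimum away from the solution.

    Working in the sup norm costs constants only, such as the dimension in [ler_norm_dotv]. *)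

Lemma within_cvg (T U : topologicalType) I (D : set T) (f : T -> U) (x : T)
    (F : set_system I) (FF : Filter F) (u : I -> T) :
  {within D, continuous f} -> D x -> (\forall i \near F, D (u i)) ->
  u @ F --> x -> f (u i) @[i --> F] --> f x.
Proof.
move=> /subspace_continuousP fc Dx Du ux; apply: cvg_trans (fc _ Dx).
move=> V /= /ux; rewrite /= !nbhs_simpl /= => h.
by apply: filterS2 Du h => i Di; apply.
Qed.

Lemma lipschitz_continuous (R : realType) (V W : normedModType R) (f : V -> W)
    (K : R) : (forall u v, `|f u - f v| <= K * `|u - v|) -> continuous f.
Proof.
move=> fK u; apply/cvgrPdist_le => e e0; near=> v.
(* [K] may be zero or negative, so a positive constant above it is used for the division. *)
have K0 : 0 < `|K| + 1 by rewrite ltr_wpDl.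
apply: le_trans (fK _ _) _; apply: (@le_trans _ _ ((`|K| + 1) * `|u - v|)).
  by rewrite ler_wpM2r // (le_trans (ler_norm K)) // lerDl.
rewrite -ler_pdivlMl //.
near: v; apply: cvgr_dist_le; first exact: cvg_id.
by rewrite mulr_gt0 ?invr_gt0.
Unshelve. all: by end_near. Qed.

Section dotv.
Context {R : realType} {k : nat}.
Implicit Types u v w : 'rV[R]_k.

Lemma dotvC u v : dotv u v = dotv v u.
Proof. by apply: eq_bigr => j _; rewrite mulrC. Qed.

Lemma dotvDl u v w : dotv (u + v) w = dotv u w + dotv v w.
Proof. by rewrite -big_split; apply: eq_bigr => j _; rewrite mxE mulrDl. Qed.

Lemma dotvZl a u w : dotv (a *: u) w = a * dotv u w.
Proof. by rewrite mulr_sumr; apply: eq_bigr => j _; rewrite mxE mulrA. Qed.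

Lemma dotvNl u w : dotv (- u) w = - dotv u w.
Proof. by rewrite -scaleN1r dotvZl mulN1r. Qed.

Lemma dotvBl u v w : dotv (u - v) w = dotv u w - dotv v w.
Proof. by rewrite dotvDl dotvNl. Qed.

Lemma dotvDr u v w : dotv u (v + w) = dotv u v + dotv u w.
Proof. by rewrite !(dotvC u) dotvDl. Qed.

Lemma dotvZr a u w : dotv u (a *: w) = a * dotv u w.
Proof. by rewrite !(dotvC u) dotvZl. Qed.

Lemma dotvNr u w : dotv u (- w) = - dotv u w.
Proof. by rewrite !(dotvC u) dotvNl. Qed.

Lemma dotvBr u v w : dotv u (v - w) = dotv u v - dotv u w.
Proof. by rewrite !(dotvC u) dotvBl. Qed.

Lemma dotv0r u : dotv u 0 = 0.
Proof. by rewrite -(scale0r 0) dotvZr mul0r. Qed.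

Lemma dotv0l u : dotv 0 u = 0.
Proof. by rewrite dotvC dotv0r. Qed.

Lemma dotv_sumr I (r : seq I) (Q : pred I) (f : I -> 'rV[R]_k) u :
  dotv u (\sum_(i <- r | Q i) f i) = \sum_(i <- r | Q i) dotv u (f i).
Proof. by elim/big_rec2: _ => [|i y1 y2 _ <-]; rewrite ?dotv0r ?dotvDr. Qed.

Lemma dotvv_ge0 u : 0 <= dotv u u.
Proof. by apply: sumr_ge0 => j _; rewrite -expr2 sqr_ge0. Qed.

Lemma dotvv_eq0 u : dotv u u = 0 -> u = 0.
Proof.
move=> /eqP; rewrite psumr_eq0; last by move=> j _; rewrite -expr2 sqr_ge0.
move=> /allP u0; apply/rowP => j; rewrite mxE; apply/eqP.
have := u0 j; rewrite mem_index_enum => /(_ isT) /=.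
by rewrite -expr2 sqrf_eq0.
Qed.

Lemma dotv_sqrD u v (t : R) : dotv (u + t *: v) (u + t *: v) =
  dotv u u + t * (2 * dotv u v) + t ^+ 2 * dotv v v.
Proof. by rewrite dotvDl !dotvDr !(dotvZl, dotvZr) (dotvC v u); ring. Qed.

Lemma ler_coord_norm u j : `|u 0 j| <= `|u|.
Proof.
rewrite [leRHS]/Num.norm /= mx_normrE.
by apply/bigmax_geP; right; exists (ord0, j).
Qed.

Lemma ler_normP u a : 0 <= a -> (forall j, `|u 0 j| <= a) -> `|u| <= a.
Proof.
move=> a0 ua; rewrite /Num.norm /= mx_normrE; apply/bigmax_leP; split => // -[i j] _.
by rewrite ord1 ua.
Qed.

Lemma ler_norm_dotv u v : `|dotv u v| <= k%:R * `|u| * `|v|.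
Proof.
apply: le_trans (ler_norm_sum _ _ _) _.
apply: (@le_trans _ _ (\sum_(j < k) `|u| * `|v|)).
  by apply: ler_sum => j _; rewrite normrM ler_pM // ler_coord_norm.
by rewrite sumr_const card_ord -mulrA mulr_natl.
Qed.

Lemma cvg_coord T (F : set_system T) (FF : Filter F) (f : T -> 'rV[R]_k) u j :
  f @ F --> u -> f x 0 j @[x --> F] --> u 0 j.
Proof.
move=> fu; apply: (@cvg_comp _ _ _ f (fun M : 'rV[R]_k => M 0 j) _ _ _ fu).
exact: coord_continuous.
Qed.

Lemma cvg_dotv T (F : set_system T) (FF : Filter F) (f g : T -> 'rV[R]_k) u v :
  f @ F --> u -> g @ F --> v -> dotv (f x) (g x) @[x --> F] --> dotv u v.
Proof.
move=> fu gv.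
apply: cvg_big => [|j _]; first exact: add_continuous.
by apply: cvgM; exact: cvg_coord.
Qed.

Lemma dotv_continuous u : continuous (dotv u).
Proof.
by move=> v; apply: (@cvg_dotv _ (nbhs v) _ (cst u) id) => //; exact: cvg_cst.
Qed.

Lemma cvg_lincomb (V : normedModType R) (y : 'I_k -> V)
    T (F : set_system T) (FF : Filter F) (f : T -> 'rV[R]_k) u :
  f @ F --> u ->
  \sum_j f x 0 j *: y j @[x --> F] --> \sum_j u 0 j *: y j.
Proof.
move=> fu; apply: cvg_big => [|j _]; first exact: add_continuous.
by apply: cvgZr_tmp; exact: cvg_coord.
Qed.

End dotv.

(** * Convex sets and strict separation of compact convex sets *)

Section convexity.
Context {R : realType} {k : nat}.
Implicit Types A B : set 'rV[R]_k.

(** Convexity with a plain real weight and two inequalities, instead of the interval-typed weight of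
    [convex_set]. *)
Definition segment_closed A := forall x y (t : R), A x -> A y ->
  0 <= t -> t <= 1 -> A (t *: x + (1 - t) *: y).

Lemma convex_segment_closed A : convex_set A -> segment_closed A.
Proof.
move=> cA x y t Ax Ay t0 t1.
have tp : Itv.spec (@Itv.num_sem R) (Itv.Real `[0%Z, 1%Z]) t.
  by rewrite /Itv.spec /= /Itv.num_sem /= realE t0 /= in_itv /= t0 t1.
have := cA x y (Itv.mk tp) (mem_set Ax) (mem_set Ay).
by rewrite inE.
Qed.

Lemma segment_closedI A B :
  segment_closed A -> segment_closed B -> segment_closed (A `&` B).
Proof. by move=> cA cB x y t [] Ax Bx [] Ay By t0 t1; split; [exact: cA|exact: cB]. Qed.

Lemma segment_closed_line A x y t : segment_closed A -> A x -> A y ->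
  0 <= t -> t <= 1 -> A (x + t *: (y - x)).
Proof.
move=> cA Ax Ay t0 t1.
have -> : x + t *: (y - x) = t *: y + (1 - t) *: x.
  by apply/rowP => j; rewrite !mxE; ring.
exact: cA.
Qed.

Lemma segment_closed_dotv_eq (c : 'rV[R]_k) a :
  segment_closed [set u | dotv c u = a].
Proof.
move=> x y t /= cx cy _ _; rewrite dotvDr !dotvZr cx cy.
by rewrite -mulrDl addrC subrK mul1r.
Qed.

Lemma closed_dotv_eq (c : 'rV[R]_k) a : closed [set u | dotv c u = a].
Proof.
have -> : [set u | dotv c u = a] = dotv c @^-1` [set a] by [].
by apply: closed_comp; [move=> x _; exact: dotv_continuous|exact: closed_eq].
Qed.

(** First-order optimality along a segment: [a] is the slope at 0 and [b] collects the quadratic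
    remainder. *)
Lemma first_order_ge0 (a b : R) :
  (forall t, 0 < t -> t <= 1 -> 0 <= t * a + t ^+ 2 * b) -> 0 <= a.
Proof.
move=> h; rewrite leNgt; apply/negP => a0.
have := h 1 ltr01 (lexx _); rewrite expr1n !mul1r => ab.
have b0 : 0 < b by lra.
(* The minimizer of [t * a + t ^+ 2 * b], where the value is [- a ^+ 2 / (4 * b)]. It is at most 1
   because [t = 1] gave [- a <= b]. *)
have tb : 0 < - a / (2 * b) by rewrite divr_gt0 // ?oppr_gt0 // mulr_gt0.
have tb1 : - a / (2 * b) <= 1 by rewrite ler_pdivrMr ?mulr_gt0 //; lra.
have := h _ tb tb1.
have -> : - a / (2 * b) * a + (- a / (2 * b)) ^+ 2 * b = - (a ^+ 2 / (4 * b)).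
  field; rewrite gt_eqF //.
rewrite oppr_ge0 leNgt divr_gt0 // ?exprn_even_gt0 //= ?lt_eqF //.
by rewrite mulr_gt0.
Qed.

(** Take a closest pair [(x, y)] for the Euclidean distance. First-order optimality in each variable
    shows that [c = y - x] is maximal over [A] at [x] and minimal over [B] at [y]; the hyperplane
    halfway between separates strictly. *)
Lemma separation A B : compact A -> compact B -> A !=set0 -> B !=set0 ->
  segment_closed A -> segment_closed B -> A `&` B = set0 ->
  exists (c : 'rV[R]_k) a, (forall u, A u -> dotv c u < a) /\
                           (forall u, B u -> a < dotv c u).
Proof.
move=> kA kB [a0 Aa0] [b0 Bb0] cA cB AB.
pose f (z : 'rV[R]_k * 'rV[R]_k) : R := dotv (z.2 - z.1) (z.2 - z.1).
have fc : continuous f.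
  by move=> z; apply: cvg_dotv; apply: cvgB;
    [exact: cvg_snd|exact: cvg_fst|exact: cvg_snd|exact: cvg_fst].
have AB0 : A `*` B !=set0 by exists (a0, b0).
have [[x y] /[!inE] -[/= Ax By] xy] :=
  compact_EVT_min AB0 (compact_setX kA kB) (continuous_subspaceT fc).
pose c := y - x.
have c0 : 0 < dotv c c.
  rewrite lt_neqAle dotvv_ge0 andbT; apply/eqP => /esym /dotvv_eq0 /eqP.
  rewrite subr_eq0 => /eqP yx; have : (A `&` B) x by split=> //; rewrite -yx.
  by rewrite AB.
have hA u : A u -> dotv c u <= dotv c x.
  move=> Au; suff : 0 <= 2 * dotv c (x - u) by rewrite dotvBr; lra.
  apply: (@first_order_ge0 _ (dotv (x - u) (x - u))) => t t0 t1.
  have /xy : (x + t *: (u - x), y) \in A `*` B.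
    by rewrite inE; split=> //=; exact: segment_closed_line (ltW t0) t1.
  rewrite /f /= opprD addrA -scalerN opprB -/c dotv_sqrD; lra.
have hB u : B u -> dotv c y <= dotv c u.
  move=> Bu; suff : 0 <= 2 * dotv c (u - y) by rewrite dotvBr; lra.
  apply: (@first_order_ge0 _ (dotv (u - y) (u - y))) => t t0 t1.
  have /xy : (x, y + t *: (u - y)) \in A `*` B.
    by rewrite inE; split=> //=; exact: segment_closed_line (ltW t0) t1.
  rewrite /f /= addrAC -/c dotv_sqrD; lra.
exists c, ((dotv c x + dotv c y) / 2).
have cyx : dotv c y - dotv c x = dotv c c by rewrite -dotvBr.
by split=> u hu; [have := hA u hu|have := hB u hu]; lra.
Qed.

End convexity.

(** * Existence of solutions *)

Section vi_existence.
Context {R : realType} {k : nat}.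

(* If the intersection C of all the sets but the last one, D, misses D, a
   hyperplane strictly separates C from D; the traces of the remaining sets on
   it cover U there and any all-but-one of them meet, by segments joining C to
   D, so by induction they all meet on it, which is impossible. *)
Lemma klee_intersection (I : eqType) (A : I -> set 'rV[R]_k) (s : seq I)
    (U : set 'rV[R]_k) :
  uniq s -> s != [::] -> compact U -> segment_closed U ->
  (forall i, i \in s -> closed (A i) /\ segment_closed (A i)) ->
  (forall u, U u -> exists2 i, i \in s & A i u) ->
  (forall i, i \in s ->
     exists2 u, U u & forall j, j \in s -> j != i -> A j u) ->
  exists2 u, U u & forall j, j \in s -> A j u.
Proof.
elim: s U => [//|m s IH] U /= /andP[ms us] _ kU cU cA Us omit.
have [s0|s0] := eqVneq s [::].
  subst s; have [u Uu _] := omit m (mem_head _ _).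
  exists u => // j; rewrite inE => /eqP ->.
  by have [i] := Us _ Uu; rewrite inE => /eqP ->.
have cAs j : j \in s -> closed (A j) /\ segment_closed (A j).
  by move=> js; apply: cA; rewrite inE js orbT.
have [cAm sAm] := cA m (mem_head _ _).
pose C := U `&` \bigcap_(j in [set` s]) A j.
have kC : compact C.
  by apply: compact_closedI => //; apply: closed_bigI => j /= /cAs[].
have sC : segment_closed C.
  apply: segment_closedI => // x y t hx hy t0 t1 j js.
  by have [_] := cAs _ js; apply => //; [exact: hx|exact: hy].
pose D := U `&` A m.
have [CD|/set0P[u [[Uu Au] [_ Am]]]] := eqVneq (C `&` D) set0; last first.
  by exists u => // j; rewrite inE => /orP[/eqP -> //|]; exact: Au.
have [u1 Uu1 Au1] := omit m (mem_head _ _).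
have Cu1 : C u1.
  split=> // j /= js; apply: Au1; first by rewrite inE js orbT.
  by apply: contraNneq ms => <-.
have dA i : i \in s -> exists2 u, D u & forall j, j \in s -> j != i -> A j u.
  move=> si; have [|u Uu Au] := omit i; first by rewrite inE si orbT.
  exists u; last by move=> j js; apply: Au; rewrite inE js orbT.
  split=> //; apply: Au; first exact: mem_head.
  by apply: contraNneq ms => ->.
have [u2 Du2] : D !=set0.
  have [i si] : exists i, i \in s.
    by case: (s) s0 => // i s' _; exists i; exact: mem_head.
  by have [u Du _] := dA _ si; exists u.
have [c [a [Ca Da]]] := separation kC (compact_closedI kU cAm) (ex_intro _ _ Cu1)
  (ex_intro _ _ Du2) sC (segment_closedI cU sAm) CD.
have [|||u|i si|u [Uu /= ua] Au] := IH (U `&` [set u | dotv c u = a]) us s0.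
- exact: compact_closedI kU (@closed_dotv_eq _ _ _ _).
- exact: segment_closedI cU (@segment_closed_dotv_eq _ _ _ _).
- exact: cAs.
- move=> [Uu /= ua]; have [i] := Us _ Uu; rewrite inE => /orP[/eqP -> Amu|].
    by have := Da u (conj Uu Amu); rewrite ua ltxx.
  by move=> si Aiu; exists i.
- have [v Dv Av] := dA _ si.
  have lv := Da _ Dv; have lu := Ca _ Cu1.
  have d0 : 0 < dotv c v - dotv c u1 by rewrite subr_gt0 (lt_trans lu).
  pose t := (a - dotv c u1) / (dotv c v - dotv c u1).
  have t0 : 0 <= t by rewrite divr_ge0 ?ltW // subr_gt0.
  have t1 : t <= 1 by rewrite ler_pdivrMr // mul1r lerB // ltW.
  exists (t *: v + (1 - t) *: u1).
    split; first by apply: cU => //; case: Dv.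
    rewrite /= dotvDr !dotvZr /t; field.
    by rewrite gt_eqF.
  move=> j js ji; have [_] := cAs _ js; apply => //; first exact: Av.
  by have [_] := Cu1; apply.
by have := Ca u (conj Uu Au); rewrite ua ltxx.
Qed.

Variable (X : set 'rV[R]_k) (F : 'rV[R]_k -> 'rV[R]_k).

(** The weights are indexed by all of ['I_m] and vanish outside [s], so the ambient space stays the
    same when [s] shrinks in the induction of [minty_KKM]. *)
Definition simplex_on m (s : seq 'I_m) : set 'rV[R]_m :=
  [set l | [/\ forall j, 0 <= l 0 j, \sum_j l 0 j = 1 &
               forall j, j \notin s -> l 0 j = 0]].

Lemma simplex_on_closed m (s : seq 'I_m) : closed (simplex_on s).
Proof.
have cC j : continuous (fun l : 'rV[R]_m => l 0 j) by exact: coord_continuous.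
have -> : simplex_on s =
   \bigcap_j [set l : 'rV[R]_m | 0 <= l 0 j] `&`
   ([set l | dotv (\row_j 1) l = 1] `&`
    \bigcap_(j in [set j | j \notin s]) [set l : 'rV[R]_m | l 0 j = 0]).
  rewrite predeqE => l; split.
    move=> [l0 l1 ls]; split; first by move=> j _; exact: l0.
    split; last by move=> j; exact: ls.
    by rewrite /= -[RHS]l1; apply: eq_bigr => j _; rewrite mxE mul1r.
  move=> [l0 [l1 ls]]; split=> //; first by move=> j; exact: l0.
  by rewrite -[RHS]l1; apply: eq_bigr => j _; rewrite mxE mul1r.
apply: closedI; last apply: closedI.
- apply: closed_bigI => j _.
  by apply: (@closed_comp _ _ (fun l : 'rV[R]_m => l 0 j) [set x | 0 <= x]);
    [move=> x _; exact: cC|exact: closed_ge].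
- exact: closed_dotv_eq.
- apply: closed_bigI => j _.
  by apply: (@closed_comp _ _ (fun l : 'rV[R]_m => l 0 j) [set 0]);
    [move=> x _; exact: cC|exact: closed_eq].
Qed.

Lemma simplex_on_compact m (s : seq 'I_m) : compact (simplex_on s).
Proof.
apply: bounded_closed_compact; last exact: simplex_on_closed.
exists 1; split=> // M M1 l [l0 l1 _]; apply: ler_normP => [|j].
  by rewrite ltW // (lt_trans _ M1).
rewrite ger0_norm // (le_trans _ (ltW M1)) // -l1 (bigD1 j) //= lerDl.
by apply: sumr_ge0.
Qed.

Definition hull m (y : 'I_m -> 'rV[R]_k) (s : seq 'I_m) : set 'rV[R]_k :=
  (fun l : 'rV[R]_m => \sum_j l 0 j *: y j) @` simplex_on s.

Lemma hull_compact m (y : 'I_m -> 'rV[R]_k) s : compact (hull y s).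
Proof.
apply: continuous_compact; last exact: simplex_on_compact.
apply: continuous_subspaceT => l.
by apply: (@cvg_lincomb _ _ _ y _ (nbhs l) _ id).
Qed.

Lemma hull_segment_closed m (y : 'I_m -> 'rV[R]_k) s :
  segment_closed (hull y s).
Proof.
move=> _ _ t [l [l0 l1 ls] <-] [l' [l0' l1' ls'] <-] t0 t1.
exists (t *: l + (1 - t) *: l').
  split=> [j||j js]; rewrite ?mxE.
  - by rewrite addr_ge0 // mulr_ge0 // subr_ge0.
  - under eq_bigr do rewrite !mxE.
    by rewrite big_split /= -!mulr_sumr l1 l1' !mulr1 addrC subrK.
  - by rewrite ls // ls' // !mulr0 addr0.
rewrite !scaler_sumr -big_split; apply: eq_bigr => j _.
by apply/rowP => i; rewrite !mxE; ring.
Qed.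

Hypotheses (X_cvx : segment_closed X) (X_cpt : compact X)
  (F_pseudo : strictly_pseudomonotone X F).

(** Since [F] is taken at [y] and not at the unknown [x], this is a closed half-space (or
    everything), whatever the regularity of [F]. *)
Definition minty (y : 'rV[R]_k) : set 'rV[R]_k :=
  [set x | 0 <= dotv (F y) (y - x)].

Lemma minty_closed y : closed (minty y).
Proof.
pose f (x : 'rV[R]_k) : R := dotv (F y) (y - x).
have -> : minty y = f @^-1` [set x | 0 <= x] by [].
apply: closed_comp; last exact: closed_ge.
move=> x _; apply: (@cvg_dotv _ _ _ (nbhs x) _ (cst (F y))).
  exact: cvg_cst.
by apply: cvgB; [exact: cvg_cst|exact: cvg_id].
Qed.

Lemma minty_segment_closed y : segment_closed (minty y).
Proof.
move=> u v t; rewrite /minty /= => hu hv t0 t1.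
have -> : y - (t *: u + (1 - t) *: v) = t *: (y - u) + (1 - t) *: (y - v).
  by apply/rowP => j; rewrite !mxE; ring.
by rewrite dotvDr !dotvZr addr_ge0 // mulr_ge0 // subr_ge0.
Qed.

(* Pseudo-monotonicity is what makes the Minty sets a KKM family; since they are
   convex, no fixed point theorem is needed. *)
Lemma minty_KKM m (y : 'I_m -> 'rV[R]_k) (s : seq 'I_m) :
  (forall j, X (y j)) -> uniq s -> s != [::] ->
  exists2 u, (X `&` hull y s) u & forall j, j \in s -> minty (y j) u.
Proof.
move=> Xy; have [n] := ubnP (size s); elim: n s => // n IH s sn us s0.
apply: (@klee_intersection _ (minty \o y)) => //.
- apply: compact_closedI => //; apply: compact_closed; last exact: hull_compact.
  exact: norm_hausdorff.
- exact: segment_closedI (@hull_segment_closed _ _ _).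
- by move=> i _; split; [exact: minty_closed|exact: minty_segment_closed].
(* Covering: if [u] missed every set, pseudo-monotonicity would make each [dotv (F u) (u - y j)]
   positive for [j] in [s], although their average with the weights [l] of [u] is zero. *)
- move=> u [Xu [l [l0 l1 ls] lu]]; apply/not_exists2P => no.
  have lt0 j : j \in s -> 0 < dotv (F u) (u - y j).
    move=> js; have [//|] := no j; rewrite /minty /= => /negP.
    rewrite -ltNge -opprB dotvNr oppr_lt0 => h.
    apply: F_pseudo => //; last exact: ltW.
    by move=> uy; move: h; rewrite uy subrr dotv0r ltxx.
  have : \sum_j l 0 j * dotv (F u) (u - y j) = 0.
    under eq_bigr do rewrite -dotvZr scalerBr.
    by rewrite -dotv_sumr sumrB -scaler_suml l1 scale1r lu subrr dotv0r.
  have ge0 j : true -> 0 <= l 0 j * dotv (F u) (u - y j).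
    move=> _; have [js|js] := boolP (j \in s).
      by rewrite mulr_ge0 // ltW // lt0.
    by rewrite ls // mul0r.
  move=> /eqP; rewrite psumr_eq0 // => /allP z.
  have lz j : l 0 j = 0.
    have [js|/ls //] := boolP (j \in s).
    have := z j; rewrite mem_index_enum => /(_ isT) /=.
    by rewrite mulf_eq0 (gt_eqF (lt0 _ js)) orbF => /eqP.
  move: l1; under eq_bigr do rewrite lz.
  by rewrite big1 // => /eqP; rewrite eq_sym oner_eq0.
(* All sets but the [i]-th meet: the induction hypothesis for [rem i s] gives a common point. If
   nothing remains, any point of the hull in [X] will do, for instance [y i]. *)
- move=> i si; have [r0|r0] := eqVneq (rem i s) [::].
    exists (y i).
      split=> //; exists (\row_j (j == i)%:R).
        split=> [j||j js]; rewrite ?mxE ?ler0n //.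
          by rewrite (bigD1 i) //= mxE eqxx big1 ?addr0 // => j /negPf ji; rewrite mxE ji.
        by rewrite (_ : (j == i) = false) //; apply: contraNF js => /eqP ->.
      by rewrite (bigD1 i) //= mxE eqxx scale1r big1 ?addr0 // => j /negPf ji;
        rewrite mxE ji scale0r.
    move=> j js ji; have : j \in rem i s by rewrite mem_rem_uniq // !inE ji.
    by rewrite r0.
  have [||//|u [Xu [l [l0 l1 ls] lu]] hu] := IH (rem i s).
  + by rewrite size_rem //; case: (s) si sn.
  + exact: rem_uniq.
  exists u.
    split=> //; exists l => //; split=> // j js; apply: ls.
    by rewrite mem_rem_uniq // !inE negb_and js orbT.
  by move=> j js ji; apply: hu; rewrite mem_rem_uniq // !inE ji.
Qed.

(** By compactness of [X] it is enough that finitely many sets meet inside [X], which is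
    [minty_KKM]. *)
Lemma minty_solution : X !=set0 ->
  exists2 x, X x & forall y, X y -> minty y x.
Proof.
move=> [x0 Xx0]; move: X_cpt; rewrite compact_In0 => cX.
have [||x hx] := cX 'rV[R]_k X (fun y => X `&` minty y).
- by exists minty => // y _; exact: minty_closed.
- move=> D' D'X; pose s := enum_fset D'.
  pose y j := tnth (in_tuple s) j.
  have ys j : y j \in D' by exact: mem_tnth.
  (* The empty subfamily is treated apart, since [minty_KKM] requires a nonempty list. *)
  have [s0|s0] := eqVneq (enum 'I_(size s)) [::].
    exists x0 => z /= zD'; have : z \in in_tuple s by [].
    by move=> /tnthP[j _]; have := mem_enum 'I_(size s) j; rewrite s0.
  have [|u [Xu _] hu] := minty_KKM (y := y) _ (enum_uniq _) s0.
    by move=> j; have := D'X _ (ys j); rewrite inE.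
  exists u => z /= zD'; have : z \in in_tuple s by [].
  by move=> /tnthP[j ->]; split=> //; apply: hu; rewrite mem_enum.
exists x; first by have [] := hx _ Xx0.
by move=> y /hx[].
Qed.

Lemma VI_solution_unique : X !=set0 -> {within X, continuous F} ->
  exists x, unique (VI_solution X F) x.
Proof.
move=> X0 Fc; have [x Xx hx] := minty_solution X0; exists x.
(* Minty's argument: the condition at [x + t *: (y - x)], divided by [t], passes to the limit as [t]
   decreases to 0 because [F] is continuous within [X]. *)
have VIx y : X y -> 0 <= dotv (F x) (y - x).
  move=> Xy.
  have u_cvg : x + t *: (y - x) @[t --> 0^'+] --> x.
    rewrite -[X in _ --> X](_ : x + 0 *: (y - x) = x); last first.
      by rewrite scale0r addr0.
    apply: cvgD; first exact: cvg_cst.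
    by apply: cvgZr_tmp; apply: cvg_at_right_filter; exact: cvg_id.
  have uX : \forall t \near 0^'+, X (x + t *: (y - x)).
    near=> t; apply: segment_closed_line => //; apply: ltW; near: t.
    exact: nbhs_right_lt.
  have Fu : dotv (F (x + t *: (y - x))) (y - x) @[t --> 0^'+] --> dotv (F x) (y - x).
    by apply: cvg_dotv; [exact: within_cvg Xx uX u_cvg|exact: cvg_cst].
  apply: (cvgr_to_ge Fu); near=> t.
  have t0 : 0 < t by near: t; exact: nbhs_right_gt.
  have : minty (x + t *: (y - x)) x by apply: hx; near: t; exact: uX.
  by rewrite /minty /= addrAC subrr add0r dotvZr pmulr_rge0.
(* For a second solution [y], the inequality at [y] tested with [x] and strict pseudo-monotonicity
   contradict the inequality at [x] tested with [y]. *)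
split=> // y [Xy hy]; apply: contrapT => xy.
have : 0 < dotv (F x) (x - y) by apply: F_pseudo => //; exact: hy.
have := VIx y Xy.
by rewrite -opprB dotvNr oppr_ge0 leNgt => /negP.
Unshelve. all: by end_near. Qed.

End vi_existence.

(** * Norms and prox mappings *)

Section norm_equivalence.
Context {R : realType} {k : nat} (N : 'rV[R]_k -> R) (NP : is_norm N).

Let N0 : N 0 = 0.
Proof. by case: NP => _ NZ _; rewrite -(scale0r 0) NZ normr0 mul0r. Qed.

Let NN u : N (- u) = N u.
Proof. by case: NP => _ NZ _; rewrite -scaleN1r NZ normrN1 mul1r. Qed.

Let N_ge0 u : 0 <= N u.
Proof.
case: NP => _ _ ND; have := ND u (- u).
by rewrite subrr N0 NN -mulr2n pmulrn_lge0.
Qed.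

Let N_le : exists2 K, 0 < K & forall u, N u <= K * `|u|.
Proof.
case: NP => _ NZ ND; exists (\sum_j N (delta_mx 0 j) + 1).
  by rewrite ltr_wpDl // sumr_ge0.
move=> u; rewrite {1}(row_sum_delta u) mulrDl mul1r.
apply: (@le_trans _ _ (\sum_j N (u 0 j *: delta_mx 0 j))).
  elim/big_ind2 : _ => [|a b c e ab ce|//]; first by rewrite N0.
  by apply: le_trans (ND _ _) _; exact: lerD.
rewrite mulr_suml -[leLHS]addr0 lerD // ler_sum // => j _.
by rewrite NZ mulrC ler_wpM2l // ler_coord_norm.
Qed.

Let N_cont : continuous N.
Proof.
case: NP => _ _ ND; have [K K0 NK] := N_le.
have NB u v : `|N u - N v| <= K * `|u - v|.
  have sub a b : N a - N b <= K * `|a - b|.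
    by rewrite lerBlDr (le_trans _ (lerD (NK (a - b)) (lexx _))) // -{1}(subrK b a).
  by rewrite ler_norml sub andbT lerNl opprB distrC.
exact: lipschitz_continuous NB.
Qed.

Let N_ge : exists2 K, 0 < K & forall u, `|u| <= K * N u.
Proof.
case: NP => Nz NZ _.
pose S := [set u : 'rV[R]_k | `|u| = 1].
have Sc : closed S.
  have -> : S = (fun u => `|u|) @^-1` [set 1] by [].
  by apply: closed_comp; [move=> u _; exact: norm_continuous|exact: closed_eq].
have kS : compact S.
  apply: bounded_closed_compact => //; exists 1; split=> // M M1 u Su.
  have h : `|u| <= M by rewrite (Su : `|u| = 1) ltW.
  exact: h.
(* The sphere is empty only in dimension 0, where every vector is zero. Otherwise the constant is
   the inverse of the minimum of [N] on the sphere. *)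
have [S0|/set0P S0] := eqVneq S set0.
  exists 1 => // u; have [->|u0] := eqVneq u 0.
    by rewrite normr0 mul1r.
  have : S (`|u|^-1 *: u).
    by rewrite /S /= normrZ normfV normr_id mulVf // normr_eq0.
  by rewrite S0.
have [s /[!inE] Ss sm] := compact_EVT_min S0 kS (continuous_subspaceT N_cont).
have s0 : 0 < N s.
  rewrite lt_neqAle N_ge0 andbT; apply/eqP => /esym /Nz s0.
  by move: Ss; rewrite /S /= s0 normr0 => /eqP; rewrite eq_sym oner_eq0.
exists (N s)^-1 => [|u]; first by rewrite invr_gt0.
have [->|u0] := eqVneq u 0; first by rewrite N0 normr0 mulr0.
have : `|u|^-1 *: u \in S.
  by rewrite inE /S /= normrZ normfV normr_id mulVf // normr_eq0.
move=> /sm; rewrite NZ normfV normr_id ler_pdivlMl ?normr_gt0 // => h.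
by rewrite ler_pdivlMl // mulrC.
Qed.

Let dual_set_has_sup u : has_sup [set dotv v u | v in [set v | N v <= 1]].
Proof.
have [K2 K20 NK2] := N_ge.
split; first by exists 0, 0 => /=; rewrite ?N0 ?ler01 // dotv0l.
exists (k%:R * K2 * `|u|) => _ [v /= Nv <-].
apply: le_trans (ler_norm _) _; apply: le_trans (ler_norm_dotv _ _) _.
rewrite ler_wpM2r // ler_wpM2l //; apply: le_trans (NK2 _) _.
by rewrite ger_pMr.
Qed.

Let dual_le u a : (forall v, N v <= 1 -> dotv v u <= a) -> dual_norm N u <= a.
Proof.
move=> h; apply: ge_sup; first by case: (dual_set_has_sup u).
by move=> _ [v /= Nv <-]; exact: h.
Qed.

Let dual_ge v u : N v <= 1 -> dotv v u <= dual_norm N u.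
Proof.
by move=> Nv; apply: ub_le_sup; [case: (dual_set_has_sup u)|exists v].
Qed.

Let dual_le_norm : exists2 K, 0 <= K & forall u, dual_norm N u <= K * `|u|.
Proof.
have [K2 K20 NK2] := N_ge; exists (k%:R * K2); first by rewrite mulr_ge0 // ltW.
move=> u; apply: dual_le => v Nv.
apply: le_trans (ler_norm _) _; apply: le_trans (ler_norm_dotv _ _) _.
rewrite ler_wpM2r // ler_wpM2l //; apply: le_trans (NK2 _) _.
by rewrite ger_pMr.
Qed.

Lemma dual_norm_continuous : continuous (dual_norm N).
Proof.
have [K K0 dK] := dual_le_norm.
have sub u v : dual_norm N u - dual_norm N v <= K * `|u - v|.
  rewrite lerBlDr; apply: dual_le => a Na.
  rewrite -{1}(subrK v u) dotvDr lerD ?dual_ge //.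
  exact: le_trans (dual_ge _ Na) (dK _).
apply: (@lipschitz_continuous _ _ _ _ K) => u v.
by rewrite ler_norml sub andbT lerNl opprB distrC.
Qed.

(** One constant for both the norm and its dual, so that strong convexity, smoothness, P2 and the
    variance bounds can all be restated in the sup norm. *)
Lemma norm_equivalence : exists2 K, 0 < K &
  forall u, [/\ N u <= K * `|u|, `|u| <= K * N u,
                dual_norm N u <= K * `|u| & `|u| <= K * dual_norm N u].
Proof.
case: NP => _ NZ _.
have [K1 K10 NK1] := N_le; have [K2 K20 NK2] := N_ge.
have [K3 K30 dle] := dual_le_norm.
have d0 u : 0 <= dual_norm N u.
  by have := @dual_ge 0 u; rewrite N0 ler01 dotv0l => /(_ isT).
(* Coordinate [j] is tested against the [j]-th unit vector, with the sign of [u 0 j] and divided by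
   [K1]: this vector is in the unit ball of [N] because [N] of a unit vector is at most [K1]. *)
have uled u : `|u| <= K1 * dual_norm N u.
  apply: ler_normP => [|j]; first by rewrite mulr_ge0 // ltW.
  rewrite -ler_pdivrMl //.
  have -> : K1^-1 * `|u 0 j| = dotv ((K1^-1 * Num.sg (u 0 j)) *: delta_mx 0 j) u.
    rewrite dotvZl /dotv (bigD1 j) //= big1 => [|i ij].
      by rewrite mxE !eqxx mul1r addr0 -mulrA -normrEsg.
    by rewrite mxE (negPf ij) andbF mul0r.
  apply: dual_ge; rewrite NZ normrM normfV (gtr0_norm K10).
  have := NK1 (delta_mx 0 j).
  have d1 : `|delta_mx 0 j : 'rV[R]_k| <= 1.
    by apply: ler_normP => // i; rewrite mxE; case: (_ && _); rewrite ?normr1 ?normr0.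
  have sg1 : `|Num.sg (u 0 j)| <= 1.
    by rewrite normr_sg lern1 leq_b1.
  move=> h; rewrite -mulrA ler_pdivrMl // mulr1.
  apply: (@le_trans _ _ (1 * N (delta_mx 0 j))); first by rewrite ler_wpM2r.
  by rewrite mul1r (le_trans h) // ger_pMr.
pose K := K1 + K2 + K3.
exists K; first by rewrite ltr_wpDr // addr_gt0.
move=> u; split.
- by apply: le_trans (NK1 u) _; rewrite ler_wpM2r // /K; lra.
- by apply: le_trans (NK2 u) _; rewrite ler_wpM2r // /K; lra.
- by apply: le_trans (dle u) _; rewrite ler_wpM2r // /K; lra.
- by apply: le_trans (uled u) _; rewrite ler_wpM2r // /K; lra.
Qed.

End norm_equivalence.

(** * Prox mappings: optimality, Lipschitz dependence and descent *)

Section prox.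
Context {R : realType} {k : nat}.
Variables (A : set 'rV[R]_k) (w : 'rV[R]_k -> R) (g : 'rV[R]_k -> 'rV[R]_k).
Variables (m M : R).
Hypotheses (A0 : A !=set0) (kA : compact A) (cA : segment_closed A).
Hypothesis m_gt0 : 0 < m.
Hypothesis w_cont : {within A, continuous w}.
Hypothesis bregman_ge : forall x z, A x -> A z ->
  m / 2 * `|x - z| ^+ 2 <= bregman w g x z.
Hypothesis bregman_le : forall x z, A x -> A z ->
  bregman w g x z <= M / 2 * `|x - z| ^+ 2.

(** Up to terms constant in [z], the prox objective depends on its two arguments only through
    [q = y - g x]. This one-variable map is Lipschitz, which later gives the measurability of prox
    steps. *)
Definition tilted_argmin (q : 'rV[R]_k) :=
  xget 0 (argmin_on A (fun z => dotv q z + w z)).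

Lemma prox_tilted x y : prox A w g x y = tilted_argmin (y - g x).
Proof.
rewrite /prox /tilted_argmin; congr xget; apply/seteqP; split=> z [Az hz];
  split=> // z' /hz; rewrite /bregman !dotvBl !dotvBr; lra.
Qed.

Lemma tilted_argminP q : argmin_on A (fun z => dotv q z + w z) (tilted_argmin q).
Proof.
apply: (xgetPex 0).
have fc : {within A, continuous (fun z => dotv q z + w z)}.
  apply/subspace_continuousP => x Ax; apply: cvgD.
    by apply: cvg_within_filter; exact: dotv_continuous.
  by move/subspace_continuousP: w_cont; exact.
have [c /[!inE] Ac hc] := compact_EVT_min A0 kA fc.
by exists c; split=> // z Az; apply: hc; rewrite inE.
Qed.

Lemma tilted_argmin_in q : A (tilted_argmin q).
Proof. by have [] := tilted_argminP q. Qed.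

Lemma tilted_argmin_opt q z : A z ->
  0 <= dotv (q + g (tilted_argmin q)) (z - tilted_argmin q).
Proof.
move=> Az; have [Ap hp] := tilted_argminP q.
set p := tilted_argmin q in Ap hp *.
(* The smoothness bound [bregman_le] supplies the quadratic remainder of [w] along the segment from
   [p] to [z]. *)
apply: (@first_order_ge0 _ _ (M / 2 * `|p - z| ^+ 2)) => t t0 t1.
have Az' : A (p + t *: (z - p)) by exact: segment_closed_line (ltW t0) t1.
have := hp _ Az'; have := bregman_le Ap Az'.
have -> : p - (p + t *: (z - p)) = t *: (p - z).
  by apply/rowP => j; rewrite !mxE; ring.
have -> : bregman w g p (p + t *: (z - p)) =
    w (p + t *: (z - p)) - w p - dotv (g p) (t *: (z - p)).
  congr (_ - dotv (g p) _).
  by apply/rowP => j; rewrite !mxE; ring.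
rewrite normrZ (gtr0_norm t0) exprMn dotvZr.
rewrite (dotvDr q) dotvZr (dotvDl q (g p) (z - p)).
set a := dotv q (z - p); set b := dotv (g p) (z - p).
set c := `|_| ^+ 2 => h1 h2; lra.
Qed.

Lemma gradient_monotone x z : A x -> A z ->
  m * `|x - z| ^+ 2 <= dotv (g x - g z) (x - z).
Proof.
move=> Ax Az; have := bregman_ge Ax Az; have := bregman_ge Az Ax.
rewrite /bregman (distrC z x) dotvBl -(opprB x z) !dotvNr.
by set c := `|_| ^+ 2; lra.
Qed.

(** Add the optimality conditions of the two minimizers, each tested with the other, and use the
    strong monotonicity of [g]. The factor [k%:R] is the price of Cauchy-Schwarz in the sup norm. *)
Lemma tilted_argmin_lipschitz q q' :
  `|tilted_argmin q - tilted_argmin q'| <= k%:R / m * `|q - q'|.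
Proof.
set p := tilted_argmin q; set p' := tilted_argmin q'.
have Ap := tilted_argmin_in q; have Ap' := tilted_argmin_in q'.
have := tilted_argmin_opt q Ap'; have := tilted_argmin_opt q' Ap.
have := gradient_monotone Ap Ap'; rewrite -/p -/p' => h1 h2 h3.
have h4 : m * `|p - p'| ^+ 2 <= dotv (q' - q) (p - p').
  move: h1 h2 h3; rewrite -(opprB p p') dotvNr !dotvBl !dotvDl; lra.
have h5 : m * `|p - p'| ^+ 2 <= k%:R * `|q - q'| * `|p - p'|.
  apply: le_trans h4 _; apply: le_trans (ler_norm _) _.
  by rewrite (distrC q); exact: ler_norm_dotv.
have [->|pp] := eqVneq p p'.
  by rewrite subrr normr0 mulr_ge0 // divr_ge0 // ltW.
have pp0 : 0 < `|p - p'| by rewrite normr_gt0 subr_eq0.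
move: h5; rewrite expr2 mulrA ler_pM2r // => h5.
by rewrite mulrAC ler_pdivlMr // mulrC.
Qed.

Lemma tilted_argmin_continuous : continuous tilted_argmin.
Proof.
exact: lipschitz_continuous tilted_argmin_lipschitz.
Qed.

Lemma prox_in x y : A (prox A w g x y).
Proof. by rewrite prox_tilted; exact: tilted_argmin_in. Qed.

(** Same argument, the minimizer being compared with [x] itself. It bounds the displacement of the
    extrapolated point. *)
Lemma prox_dist x y : A x -> `|prox A w g x y - x| <= k%:R / m * `|y|.
Proof.
move=> Ax; set p := prox A w g x y.
have Ap : A p := prox_in x y.
have := tilted_argmin_opt (y - g x) Ax; rewrite -prox_tilted -/p.
have := gradient_monotone Ap Ax => h1 h2.
have h4 : m * `|p - x| ^+ 2 <= k%:R * `|y| * `|p - x|.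
  apply: (@le_trans _ _ (dotv y (x - p))); last first.
    by rewrite distrC; apply: le_trans (ler_norm _) (ler_norm_dotv _ _).
  move: h1 h2; rewrite -(opprB p x) !dotvNr !(dotvBl, dotvDl); lra.
have [->|pp] := eqVneq p x.
  by rewrite subrr normr0 mulr_ge0 // divr_ge0 // ltW.
have pp0 : 0 < `|p - x| by rewrite normr_gt0 subr_eq0.
move: h4; rewrite expr2 mulrA ler_pM2r // => h4.
by rewrite mulrAC ler_pdivlMr // mulrC.
Qed.

(** The three-point inequality gives this with [dotv y (p - z)] and the extra term
    [- bregman w g x p]. Moving from [p] to [x] costs [dotv y (x - p)], which that extra term
    absorbs by strong convexity. *)
Lemma prox_descent x y z : A x -> A z ->
  bregman w g (prox A w g x y) z <=
    bregman w g x z - dotv y (x - z) + k%:R ^+ 2 / (2 * m) * `|y| ^+ 2.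
Proof.
move=> Ax Az; set p := prox A w g x y.
have Ap : A p := prox_in x y.
have := tilted_argmin_opt (y - g x) Az; rewrite -prox_tilted -/p => h1.
have three : bregman w g p z <= bregman w g x z - dotv y (p - z) - bregman w g x p.
  move: h1; rewrite /bregman !(dotvDl, dotvNl, dotvBr); lra.
apply: le_trans three _; have := bregman_ge Ax Ap.
have : dotv y (x - p) <= k%:R * `|y| * `|x - p|.
  by apply: le_trans (ler_norm _) (ler_norm_dotv _ _).
rewrite !dotvBr; set a := `|x - p|; set b := `|y|; set c := k%:R.
(* Young's inequality, by completing the square. *)
have : 0 <= (m * a - c * b) ^+ 2 / (2 * m).
  by rewrite divr_ge0 ?sqr_ge0 // mulr_ge0 // ltW.
have -> : (m * a - c * b) ^+ 2 / (2 * m) =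
   m / 2 * a ^+ 2 - c * b * a + c ^+ 2 / (2 * m) * b ^+ 2.
  by field; rewrite gt_eqF.
lra.
Qed.

End prox.

(** * Measurability, independence and integration *)

Section borel_row_vectors.
Context {R : realType}.

Lemma measurable_open_borelV k (U : set 'rV[R]_k) :
  open U -> measurable (U : set (borelV R k)).
Proof. by move=> oU; apply: sub_sigma_algebra. Qed.

Lemma measurable_closed_borelV k (U : set 'rV[R]_k) :
  closed U -> measurable (U : set (borelV R k)).
Proof.
move=> cU; rewrite -[U]setCK; apply: measurableC.
exact: measurable_open_borelV (closed_openC cU).
Qed.

Lemma continuous_borelV_real k (D : set 'rV[R]_k) (f : 'rV[R]_k -> R) :
  closed D -> {within D, continuous f} ->
  measurable_fun (D : set (borelV R k)) (f : borelV R k -> R).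
Proof.
move=> cD fc mD.
apply: (measurability _ (RGenOInfty.measurableE R)) => //.
move=> _ [_ [a ->] <-].
have /open_subspaceP[W oW WD] : open (f @^-1` `]a, +oo[ : set (subspace D)).
  by move/continuousP: fc; apply; exact: interval_open.
rewrite setIC -WD; apply: measurableI; first exact: measurable_open_borelV.
exact: measurable_closed_borelV.
Qed.

Lemma measurable_coord k j :
  measurable_fun setT (fun u : borelV R k => (u : 'rV[R]_k) 0 j).
Proof.
apply: continuous_borelV_real; first exact: closedT.
by apply: continuous_subspaceT; exact: coord_continuous.
Qed.

(** The sigma-algebra of [borelV] is generated by the open sets, so coordinatewise measurability
    suffices only through second countability: every open set is a countable union of cubes with
    rational centres. *)
Lemma measurable_borelV d (T : measurableType d) k (D : set T)
    (f : T -> 'rV[R]_k) :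
  (forall j, measurable_fun D (fun t => f t 0 j)) ->
  measurable_fun D (f : T -> borelV R k).
Proof.
move=> fj mD.
apply: (@measurability _ _ T (borelV R k) D f (@open 'rV[R]_k)) => //.
move=> _ [U oU <-].
pose q2v (q : 'rV[rat]_k) : 'rV[R]_k := map_mx ratr q.
pose B (q : 'rV[rat]_k) (r : nat) : set 'rV[R]_k :=
  [set v | forall j, `|v 0 j - q2v q 0 j| < r.+1%:R^-1].
(* Cubes not contained in [U] are replaced by the empty set, which lets the union run over a whole
   countable type. *)
have UE : U = \bigcup_(z : 'rV[rat]_k * nat)
    (if `[< B z.1 z.2 `<=` U >] then B z.1 z.2 else set0).
  apply/seteqP; split=> [v Uv|v [z _]]; last first.
    by case: asboolP => // BU /BU.
  have /nbhs_ballP[e /= e0 eU] : nbhs v U by exact: open_nbhs_nbhs.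
  (* Factor 2: [v] is within [r.+1%:R^-1] of the centre, and so is every other point of the cube. *)
  have [r re] : exists r : nat, 2 * r.+1%:R^-1 < e :> R.
    have [r _ hr] : \forall r \near \oo, r.+1%:R^-1 < e / 2.
      by apply: (@near_infty_natSinv_lt R (PosNum _)); rewrite divr_gt0.
    by exists r; have := hr r (leqnn _); rewrite ltr_pdivlMr // mulrC.
  have r0 : 0 < r.+1%:R^-1 :> R by rewrite invr_gt0.
  have hq j : exists q : rat, `|v 0 j - ratr q| < r.+1%:R^-1.
    have : v 0 j - r.+1%:R^-1 < v 0 j + r.+1%:R^-1 by rewrite ltrD2l gtrN.
    move=> /rat_in_itvoo[q]; rewrite in_itv /= => /andP[q1 q2].
    exists q; move: q1 q2; set e' := r.+1%:R^-1; rewrite ltr_norml => q1 q2. apply/andP; split; lra.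
  pose q : 'rV[rat]_k := \row_j sval (cid (hq j)).
  have qv j : `|v 0 j - ratr (q 0 j)| < r.+1%:R^-1.
    by rewrite mxE; case: cid.
  clearbody q.
  exists (q, r) => //; case: asboolP => /= [_ j|[]]; first by rewrite mxE.
  move=> w Bw; apply: eU; rewrite -ball_normE /=.
  apply: le_lt_trans re; apply: ler_normP => [|j]; first by rewrite mulr_ge0 // ltW.
  have := Bw j; rewrite !mxE => wj; have vj := qv j.
  rewrite -(subrKA (ratr (q 0 j))) (le_trans (ler_normD _ _)) //.
  by rewrite (distrC (ratr _)); move: wj vj; set e' := r.+1%:R^-1; lra.
rewrite UE preimage_bigcup setI_bigcupr.
apply: countable_bigcupT_measurable; first exact: countableP.
move=> [q r] /=; case: asboolP => _; last by rewrite preimage_set0 setI0.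
have -> : D `&` f @^-1` B q r =
  D `&` \bigcap_(j in [set: 'I_k]) (D `&` (fun t => f t 0 j) @^-1` ball (q2v q 0 j) r.+1%:R^-1).
  apply/seteqP; split=> t [Dt h]; split=> //.
    by move=> j _; split=> //; rewrite /= -ball_normE /= distrC; exact: h.
  by move=> j; have [_] := h j I; rewrite /= -ball_normE /= distrC.
apply: measurableI => //; apply: fin_bigcap_measurable => // j _.
by apply: fj => //; exact: measurable_ball.
Qed.

Lemma continuous_borelV k l (D : set 'rV[R]_k) (f : 'rV[R]_k -> 'rV[R]_l) :
  closed D -> {within D, continuous f} ->
  measurable_fun (D : set (borelV R k)) (f : borelV R k -> borelV R l).
Proof.
move=> cD fc mD; apply: (@measurability _ _ (borelV R k) (borelV R l) D f (@open 'rV[R]_l)) => //.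
move=> _ [U oU <-].
have /open_subspaceP[W oW WD] : open (f @^-1` U : set (subspace D)).
  by move/continuousP: fc; apply.
rewrite setIC -WD; apply: measurableI; first exact: measurable_open_borelV.
exact: measurable_closed_borelV.
Qed.

End borel_row_vectors.

(** * Integrals against a probability; functions with zero mean on an event *)

Section probability_integrals.
Context d (T : measurableType d) (R : realType) (P : probability T R).

Lemma integral_probability_cst (c : R) : (\int[P]_t (cst c%:E t) = c%:E)%E.
Proof.
rewrite integral_cst // [X in (_ * X)%E](_ : _ = 1%E) ?mule1 //.
exact: probability_setT.
Qed.

Lemma bounded_integrable (A : set T) (f : T -> R) (K : R) :
  measurable A -> measurable_fun setT f -> (forall t, 0 <= f t <= K) ->
  P.-integrable A (fun t => (f t)%:E).
Proof.
move=> mA mf fK; apply: (@measurable_bounded_integrable _ _ _ P) => //.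
- by rewrite (le_lt_trans (probability_le1 P mA)) // ltry.
- exact: measurable_funTS.
exists K; split=> [|M KM t _]; first exact: num_real.
have /andP[f0 fk] := fK t.
by apply: le_trans (ltW KM); rewrite /= ger0_norm.
Qed.

(** With [A] ranging over the events of a sigma-algebra, this says that the conditional expectation
    of [f] vanishes. Integrability is included so that sums and multiples remain legitimate. *)
Definition zero_mean (A : set T) (f : T -> R) : Prop :=
  P.-integrable A (fun t => (f t)%:E) /\ (\int[P]_(t in A) (f t)%:E = 0)%E.

Lemma zero_meanD A f h : measurable A -> zero_mean A f -> zero_mean A h ->
  zero_mean A (fun t => f t + h t).
Proof.
move=> mA [fi f0] [hi h0]; split.
  by under eq_fun do rewrite EFinD; exact: integrableD.
by under eq_integral do rewrite EFinD; rewrite integralD // f0 h0 adde0.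
Qed.

Lemma zero_meanZ A (c : R) f : measurable A -> zero_mean A f ->
  zero_mean A (fun t => c * f t).
Proof.
move=> mA [fi f0]; split.
  by under eq_fun do rewrite EFinM; exact: integrableZl.
by under eq_integral do rewrite EFinM; rewrite integralZl // f0 mule0.
Qed.

Lemma zero_mean_sum A I (r : seq I) (f : I -> T -> R) : measurable A ->
  (forall i, zero_mean A (f i)) -> zero_mean A (fun t => \sum_(i <- r) f i t).
Proof.
move=> mA fi; elim: r => [|i r IH].
  under eq_fun do rewrite big_nil; split; first exact: integrable0.
  by rewrite integral0.
by under eq_fun do rewrite big_cons; exact: zero_meanD.
Qed.

End probability_integrals.

(** * Independence of one source from the sigma-algebra of others *)

Section independent_history.
Context d (T : measurableType d) (R : realType) (P : probability T R).
Context (J : eqType) (G : J -> set (set T)).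
Hypotheses (G_measurable : forall j A, G j A -> measurable A)
  (G_setT : forall j, G j setT) (G_setI : forall j, setI_closed (G j))
  (G_indep : mutually_independent P G).

Definition history (S : set J) : set (set T) := \bigcup_(j in S) G j.

(** Finite intersections of source events: closed under intersection, unlike [history S], and still
    generating its sigma-algebra. *)
Let cylinder (S : set J) : set (set T) :=
  [set A | exists s E, [/\ uniq s, forall i, i \in s -> S i /\ G i (E i) &
                         A = \bigcap_(i in [set` s]) E i]].

Let cylinder_setI S : setI_closed (cylinder S).
Proof.
move=> _ _ [s1 [E1 [u1 h1 ->]]] [s2 [E2 [u2 h2 ->]]].
(* An index present in only one of the lists receives [setT] from the other. *)
exists (undup (s1 ++ s2)), (fun i => (if i \in s1 then E1 i else setT) `&`
                                    (if i \in s2 then E2 i else setT)).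
split; first exact: undup_uniq.
  move=> i; rewrite mem_undup mem_cat => si; split.
    by case/orP: si => [/h1|/h2] [].
  apply: G_setI.
    by have [/h1[]|_] := boolP (i \in s1).
  by have [/h2[]|_] := boolP (i \in s2).
apply/seteqP; split=> [t [t1 t2] i _|t ht].
  by split; case: ifPn => // ii; [exact: t1|exact: t2].
split=> i /= ii; have [|] := ht i; rewrite /= ?mem_undup ?mem_cat ?ii ?orbT //.
Qed.

Let cylinder_measurable S A : cylinder S A -> measurable A.
Proof.
move=> [s [E [_ h ->]]]; apply: fin_bigcap_measurable => [|i /h[_]].
  exact: finite_seq.
exact: G_measurable.
Qed.

Let history_cylinder S : <<s history S >> `<=` <<s cylinder S >>.
Proof.
apply: smallest_sub; first exact: smallest_sigma_algebra.
move=> A [j Sj GA]; apply: sub_gen_smallest; exists [:: j], (fun=> A).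
split=> // [i|]; first by rewrite inE => /eqP ->.
apply/seteqP; split=> [t ? i //|t h].
by apply: (h j); rewrite /= mem_head.
Qed.

Lemma history_measurable S A : <<s history S >> A -> measurable A.
Proof.
apply: smallest_sub; last by move=> B [j _]; exact: G_measurable.
exact: sigma_algebra_measurable.
Qed.

(** Mutual independence is used twice, for the indices [s] of the cylinder and for [j :: s]; the
    quotient of the two product formulas is the factor [P B]. *)
Let cylinder_indep S j A B : ~ S j -> cylinder S A -> G j B ->
  (P (A `&` B) = P A * P B)%E.
Proof.
move=> Sj [s [E [us h AE]]] GB.
have js : j \notin s by apply/negP => /h[].
pose E' i := if i == j then B else E i.
have E'E i : i \in s -> E' i = E i.
  by move=> si; rewrite /E'; case: eqP => // ij; rewrite ij (negPf js) in si.
have E'j : E' j = B by rewrite /E' eqxx.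
have PA : P A = (\prod_(i <- s) P (E i))%E.
  by rewrite AE; apply: G_indep => // i /h[].
have -> : A `&` B = \bigcap_(i in [set` j :: s]) E' i.
  rewrite AE; apply/seteqP; split=> [t [At Bt] i /=|t ht].
    by rewrite inE => /orP[/eqP ->|si]; [rewrite E'j|rewrite E'E //; exact: At].
  split; last by rewrite -E'j; apply: ht; rewrite /= mem_head.
  by move=> i /= si; rewrite -E'E //; apply: ht; rewrite /= inE si orbT.
rewrite G_indep /= ?js //; last first.
  move=> i; rewrite inE => /orP[/eqP ->|si]; first by rewrite E'j.
  by rewrite E'E //; have [] := h _ si.
rewrite big_cons E'j muleC PA; congr (_ * _)%E.
by apply: eq_big_seq => i si; rewrite E'E.
Qed.

(** Dynkin's theorem: the sets independent of [B] form a lambda-system containing the cylinders. *)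
Lemma history_indep S j A B : ~ S j -> <<s history S >> A -> G j B ->
  (P (A `&` B) = P A * P B)%E.
Proof.
move=> Sj + GB; have mB := G_measurable GB.
suff : <<s cylinder S >> `<=`
    [set A | measurable A /\ (P (A `&` B) = P A * P B)%E].
  by move=> h /history_cylinder /h[].
rewrite -setI_closed_g_dynkin_g_sigma_algebra; last exact: cylinder_setI.
apply: smallest_sub; last first.
  by move=> C CC; split; [exact: cylinder_measurable CC|exact: cylinder_indep CC GB].
split.
- by split=> //; rewrite setTI probability_setT mul1e.
- move=> C [mC PC]; split; first exact: measurableC.
  have -> : ~` C `&` B = B `\` C by rewrite setDE setIC.
  rewrite measureD //; last by rewrite ltey_eq fin_num_measure.
  rewrite (setIC B C) [X in (_ - X)%E]PC probability_setC // muleBl ?mul1e ?fin_num_measure //.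
- move=> F tF hF; have mF n : measurable (F n) by have [] := hF n.
  split; first exact: bigcupT_measurable.
  rewrite setI_bigcupl !measure_bigcup //; last 2 first.
  + by move=> n _; exact: measurableI.
  + exact: trivIset_setIr.
  rewrite muleC -[P B]fineK ?fin_num_measure // -nneseriesZl; last by move=> *.
  apply: eq_eseriesr => n _; have [_ e] := hF n.
  by rewrite [LHS]e fineK ?fin_num_measure // muleC.
Qed.

End independent_history.

(** * Freezing the past: integration against an independent variable *)

Section independent_integral.
Context d (T : measurableType d) (R : realType) (P : probability T R).
Context (H : set (set T)) (H_measurable : forall A, <<s H >> A -> measurable A).
Context d' (M : measurableType d') (xi : {RV P >-> M}).
Hypothesis xi_indep : forall A B, <<s H >> A -> measurable B ->
  (P (A `&` xi @^-1` B) = P A * P (xi @^-1` B))%E.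

Local Notation TH := (g_sigma_algebraType H).

Let idH_measurable : measurable_fun [set: T] (id : T -> TH).
Proof. by move=> _ A mA; rewrite setTI; exact: H_measurable. Qed.

Let idH : {mfun T >-> TH} := mfun_Sub (mem_set idH_measurable).

(** The whole past is a single variable, the identity from [T] to [T] with the coarser
    sigma-algebra. Independence says that its joint law with [xi] is the product law, so Fubini's
    theorem applies. *)
Let joint (t : T) : TH * M := (t, xi t).

Let joint_measurable : measurable_fun [set: T] joint.
Proof. by apply: measurable_fun_pair => //; exact: measurable_funPT. Qed.

Let jointM : {mfun T >-> (TH * M)%type} := mfun_Sub (mem_set joint_measurable).

Let product_law (A : set (TH * M)) : measurable A ->
  (distribution P idH \x distribution P xi)%E A = distribution P jointM A.
Proof.
apply: product_measure_unique => B C mB mC.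
by rewrite /distribution /pushforward /= -xi_indep.
Qed.

(** Tonelli for the product law: the inner integral is the conditional expectation given the past,
    with the past frozen at [t]. *)
Lemma indep_ge0_integral (f : TH * M -> \bar R) :
  measurable_fun setT f -> (forall z, 0 <= f z)%E ->
  (\int[P]_t f (t, xi t) = \int[P]_t \int[P]_s f (t, xi s))%E.
Proof.
move=> mf f0.
transitivity (\int[distribution P jointM]_z f z)%E.
  by rewrite ge0_integral_pushforward.
transitivity (\int[(distribution P idH \x distribution P xi)%E]_z f z)%E.
  by apply: eq_measure_integral => A mA _; exact/esym/product_law.
rewrite fubini_tonelli1 //.
rewrite ge0_integral_pushforward //; last 2 first.
- exact: measurable_fun_fubini_tonelli_F.
- by move=> t _; exact: integral_ge0.
apply: eq_integral => t _ /=.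
by rewrite /fubini_F ge0_integral_pushforward //; exact: measurable_fun_pair2.
Qed.

Lemma indep_integral_measurable (f : TH * M -> \bar R) :
  measurable_fun setT f -> (forall z, 0 <= f z)%E ->
  measurable_fun [set: T] (fun t => \int[P]_s f (t, xi s))%E.
Proof.
move=> mf f0.
apply: (eq_measurable_fun (fubini_F (distribution P xi) f \o idH)).
  move=> t _; rewrite /= /fubini_F ge0_integral_pushforward //.
  exact: measurable_fun_pair2.
have := (measurableT_comp
  (measurable_fun_fubini_tonelli_F (m2 := distribution P xi) f mf f0) idH_measurable).
exact.
Qed.

Lemma indep_integral (f : TH * M -> R) :
  measurable_fun setT f ->
  P.-integrable setT (fun t => (f (t, xi t))%:E) ->
  (forall t, \int[P]_s (f (t, xi s))%:E = 0)%E ->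
  (forall t, P.-integrable setT (fun s => (f (t, xi s))%:E)) ->
  (\int[P]_t (f (t, xi t))%:E = 0)%E.
Proof.
move=> mf fint f0 fi.
have mEf : measurable_fun setT (EFin \o f) by exact/measurable_EFinP.
transitivity (\int[distribution P jointM]_z (f z)%:E)%E.
  by rewrite (integral_pushforward joint_measurable mEf).
have product_int : (distribution P idH \x distribution P xi)%E.-integrable setT (EFin \o f).
  apply/integrableP; split=> //.
  have -> : (\int[(distribution P idH \x distribution P xi)%E]_z `|(EFin \o f) z| =
             \int[distribution P jointM]_z `|(EFin \o f) z|)%E.
    by apply: eq_measure_integral => A mA _; exact: product_law.
  by have /integrableP[] := integrable_pushforward joint_measurable mEf fint measurableT.
transitivity (\int[(distribution P idH \x distribution P xi)%E]_z (f z)%:E)%E.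
  by apply: eq_measure_integral => A mA _; exact/esym/product_law.
rewrite -(integral12_prod_meas1 product_int) integral0_eq // => t _.
rewrite /fubini_F -[RHS](f0 t).
rewrite (integral_pushforward (measurable_funPT xi)) //.
  exact: measurable_fun_pair2.
exact: fi.
Qed.

Context d2 (U : measurableType d2) (D : set U) (Z : T -> U).
Hypotheses (mD : measurable D) (ZD : forall t, D (Z t))
  (mZ : measurable_fun setT (Z : TH -> U)).

(** The oracle is measurable only over the feasible set, here [D]; since [Z] stays in [D], composing
    with it gives a function measurable everywhere. *)
Let comp_measurable (g : U * M -> R) : measurable_fun (D `*` setT) g ->
  measurable_fun setT (fun z : TH * M => g (Z z.1, z.2)).
Proof.
move=> mg; apply: (@measurable_comp _ _ _ _ _ _ (D `*` setT) g setT
  (fun z : TH * M => (Z z.1, z.2) : U * M)) => //.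
- exact: measurableX.
- by move=> _ [z _ <-]; split=> //; exact: ZD.
- apply: measurable_fun_pair; last exact: measurable_snd.
  exact: (measurableT_comp mZ measurable_fst).
Qed.

Lemma indep_measurable (g : U * M -> R) : measurable_fun (D `*` setT) g ->
  measurable_fun setT (fun t => g (Z t, xi t)).
Proof.
move=> mg; have := measurableT_comp (comp_measurable mg) joint_measurable.
exact.
Qed.

Lemma indep_bound (g : U * M -> R) (c : R) :
  measurable_fun (D `*` setT) g -> (forall z, 0 <= g z) ->
  (forall u, D u -> \int[P]_t (g (u, xi t))%:E <= c%:E)%E ->
  (\int[P]_t (g (Z t, xi t))%:E <= c%:E)%E.
Proof.
move=> mg g0 gc.
rewrite (@indep_ge0_integral (fun z => (g (Z z.1, z.2))%:E)); last 2 first.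
- by apply/measurable_EFinP; exact: comp_measurable.
- by move=> z; rewrite lee_fin.
apply: (@le_trans _ _ (\int[P]_t (cst c%:E t))%E).
  apply: ge0_le_integral => //.
  - by move=> t _; apply: integral_ge0 => s _; rewrite lee_fin.
  - apply: (@indep_integral_measurable (fun z => (g (Z z.1, z.2))%:E)).
      by apply/measurable_EFinP; exact: comp_measurable.
    by move=> z; rewrite lee_fin.
  - by move=> t _ /=; exact: gc.
by rewrite integral_probability_cst.
Qed.

(** Frozen at any [u], the function [g (u, xi)] is centred, and [phi] is a constant for the inner
    integral. The bounds [K] and [c] provide the joint integrability required by Fubini. *)
Lemma indep_mean_zero (phi : T -> R) (K : R) (g : U * M -> R) (c : R) :
  measurable_fun setT (phi : TH -> R) -> (forall t, `|phi t| <= K) ->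
  measurable_fun (D `*` setT) g ->
  (forall u, D u -> \int[P]_t (g (u, xi t))%:E = 0)%E ->
  (forall u, D u -> \int[P]_t `|g (u, xi t)|%:E <= c%:E)%E ->
  P.-integrable setT (fun t => (phi t * g (Z t, xi t))%:E) /\
  (\int[P]_t (phi t * g (Z t, xi t))%:E = 0)%E.
Proof.
move=> mphi phiK mg g0 gc.
have mf : measurable_fun setT (fun z : TH * M => phi z.1 * g (Z z.1, z.2)).
  apply: measurable_funM; last exact: comp_measurable.
  exact: measurableT_comp.
have mphig : measurable_fun setT (fun t : T => phi t * g (Z t, xi t)).
  exact: (measurableT_comp mf joint_measurable).
have gi u : D u -> P.-integrable setT (fun s => (g (u, xi s))%:E).
  move=> Du; apply/integrableP; split.
    apply/measurable_EFinP.
    apply: (@measurable_comp _ _ _ _ _ _ (D `*` setT) g setT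
      (fun s => (u, xi s) : U * M)) => //.
    - exact: measurableX.
    - by move=> _ [z _ <-].
    - by apply: measurable_fun_pair => //; exact: measurable_funPT.
  by apply: le_lt_trans (gc _ Du) _; exact: ltry.
have int : P.-integrable setT (fun t => (phi t * g (Z t, xi t))%:E).
  apply/integrableP; split; first exact/measurable_EFinP.
  apply: (@le_lt_trans _ _ (\int[P]_t (`|K| * `|g (Z t, xi t)|)%:E)%E).
    have mgZ : measurable_fun setT (fun t => `|g (Z t, xi t)|).
      exact: (measurableT_comp (@normr_measurable _ _) (indep_measurable mg)).
    apply: ge0_le_integral => //.
    - by apply: measurableT_comp => //; exact/measurable_EFinP.
    - by apply/measurable_EFinP; exact: measurable_funM.
    move=> t _ /=; rewrite lee_fin normrM ler_wpM2r //.
    exact: le_trans (phiK t) (ler_norm _).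
  under eq_integral do rewrite EFinM.
  rewrite ge0_integralZl_EFin //; last first.
    by apply/measurable_EFinP/measurableT_comp => //; exact: indep_measurable.
  rewrite lte_mul_pinfty // ?lee_fin //.
  apply: (@le_lt_trans _ _ c%:E); last exact: ltry.
  apply: (@indep_bound (fun z => `|g z|)) => //.
  exact: measurableT_comp.
split=> //; apply: (@indep_integral (fun z => phi z.1 * g (Z z.1, z.2))) => //.
- move=> t /=; under eq_integral do rewrite EFinM.
  by rewrite integralZl ?g0 ?mule0 //; exact: gi.
- move=> t /=; under eq_fun do rewrite EFinM.
  by apply: integrableZl => //; exact: gi.
Qed.

Lemma indep_zero_mean (A : set T) (phi : T -> R) (K : R) (g : U * M -> R) (c : R) :
  <<s H >> A ->
  measurable_fun setT (phi : TH -> R) -> (forall t, `|phi t| <= K) ->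
  measurable_fun (D `*` setT) g ->
  (forall u, D u -> \int[P]_t (g (u, xi t))%:E = 0)%E ->
  (forall u, D u -> \int[P]_t `|g (u, xi t)|%:E <= c%:E)%E ->
  zero_mean P A (fun t => phi t * g (Z t, xi t)).
Proof.
move=> HA mphi phiK mg g0 gc; have mA := H_measurable HA.
have [int _] := indep_mean_zero mphi phiK mg g0 gc.
split; first exact: integrableS int.
(* The indicator of [A] is itself measurable for the past, so it is absorbed into the weight. *)
have m1 : measurable_fun setT ((fun t => \1_A t * phi t) : TH -> R).
  by apply: measurable_funM => //; exact: (@measurable_indic _ TH).
have K1 t : `|\1_A t * phi t| <= K.
  rewrite indicE normrM; case: (t \in A) => /=.
    by rewrite normr1 mul1r.
  by rewrite normr0 mul0r (le_trans _ (phiK t)).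
have [_ <-] := indep_mean_zero m1 K1 mg g0 gc.
rewrite integral_mkcond; apply: eq_integral => t _.
by rewrite /patch indicE; case: ifP => _; rewrite ?mul1r ?mul0r.
Qed.

End independent_integral.

(** * Almost supermartingales tending to zero *)

(** If [w] stayed above [delta] from [m0] on, telescoping would bound [delta] times the partial sums
    of [gamma], which diverge. *)
Lemma eventually_small (R : realType) (e w gamma : nat -> R) (C S : R) :
  0 <= C -> (forall k, 0 <= e k) -> (forall k, 0 < gamma k) ->
  (forall n, \sum_(0 <= k < n) gamma k ^+ 2 <= S) ->
  series gamma @ \oo --> +oo ->
  (forall k, e k.+1 + gamma k * w k <= e k + C * gamma k ^+ 2) ->
  forall (delta : R) m0, 0 < delta -> exists2 m, (m0 <= m)%N & w m < delta.
Proof.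
move=> C0 e0 gamma0 gS gy step delta m0 d0.
apply: contrapT => no.
have wd m : (m0 <= m)%N -> delta <= w m.
  by move=> mm0; rewrite leNgt; apply/negP => h; apply: no; exists m.
have bound n : e (m0 + n)%N + delta * \sum_(m0 <= k < m0 + n) gamma k <=
               e m0 + C * \sum_(m0 <= k < m0 + n) gamma k ^+ 2.
  elim: n => [|n IH]; first by rewrite addn0 !big_geq // !mulr0.
  rewrite addnS !big_nat_recr ?leq_addr //= !mulrDr.
  have := step (m0 + n)%N.
  have := ler_wpM2l (ltW (gamma0 (m0 + n)%N)) (wd (m0 + n)%N (leq_addr _ _)).
  lra.
pose K := delta^-1 * (e m0 + C * S) + \sum_(0 <= k < m0) gamma k.
have gK n : series gamma (m0 + n)%N <= K.
  rewrite /series /= (big_cat_nat (n := m0)) ?leq_addr //= addrC lerD //.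
  rewrite ler_pdivlMl //.
  have := bound n; have := e0 (m0 + n)%N.
  have : C * \sum_(m0 <= k < m0 + n) gamma k ^+ 2 <= C * S.
    rewrite ler_wpM2l // (le_trans _ (gS (m0 + n)%N)) //.
    rewrite [leRHS](big_cat_nat (n := m0)) ?leq_addr //= lerDr.
    by apply: sumr_ge0 => k _; rewrite sqr_ge0.
  lra.
move/cvgryPge : gy => /(_ (K + 1))[N _ hN].
have := hN (m0 + N)%N (leq_addl _ _); have := gK N; rewrite /=; lra.
Qed.

(** * Maximal inequality and almost sure convergence to zero *)

Section almost_supermartingale.
Context d (T : measurableType d) (R : realType) (P : probability T R).
Local Open Scope ereal_scope.
Variables (H : nat -> set (set T)) (V : nat -> T -> R) (W : nat -> T -> R).
Variables (gamma : nat -> R) (C K : R).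
Hypotheses (H_measurable : forall k A, H k A -> measurable A)
  (H_setT : forall k, H k setT) (H_setI : forall k, setI_closed (H k))
  (H_mono : forall k, H k `<=` H k.+1)
  (V_H : forall k (a : R), H k [set t | (V k t < a)%R]).
Hypotheses (V_ge0 : forall k t, (0 <= V k t)%R)
  (V_meas : forall k, measurable_fun setT (V k))
  (V_le : forall k t, (V k t <= K)%R).
Hypotheses (W_ge0 : forall k t, (0 <= W k t)%R)
  (W_meas : forall k, measurable_fun setT (W k))
  (W_le : forall k t, (W k t <= K)%R).
(** [V] is small where [W] is, in a form affine in [W] so that it passes to expectations. *)
Hypothesis V_le_W : forall e : R, (0 < e)%R ->
  exists2 D : R, (0 <= D)%R & forall k t, (V k t <= e + D * W k t)%R.
Hypothesis C_ge0 : (0 <= C)%R.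
Hypotheses (gamma_gt0 : forall k, (0 < gamma k)%R)
  (gamma_sqr : cvgn (series (fun k => gamma k ^+ 2)%R))
  (gamma_sum : series gamma @ \oo --> +oo%R).
Hypothesis step : forall k A, H k A ->
  \int[P]_(t in A) (V k.+1 t)%:E + (gamma k)%:E * \int[P]_(t in A) (W k t)%:E
    <= \int[P]_(t in A) (V k t)%:E + (C * gamma k ^+ 2)%:E.

(** The window of times is half-open: for [n = m] it is empty, which starts the induction, and
    [below a m n.+1] is decided at time [n], hence an event of [H n]. *)
Let below (a : R) m n : set T := \bigcap_(k in [set k | m <= k < n]%N) [set t | (V k t < a)%R].

Let belowS a m n : (m <= n)%N -> below a m n.+1 = below a m n `&` [set t | (V n t < a)%R].
Proof.
move=> mn; apply/seteqP; split=> [t h|t [h hn] k /= /andP[mk]].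
  split; last by apply: h; rewrite /= mn ltnSn.
  by move=> k /= /andP[mk kn]; apply: h; rewrite /= mk ltnW.
by rewrite ltnS leq_eqVlt => /orP[/eqP -> //|kn]; apply: h; rewrite /= mk.
Qed.

Let below_m a m : below a m m = setT.
Proof.
apply/seteqP; split=> // t _ k /= /andP[mk km].
by have := leq_trans km mk; rewrite ltnn.
Qed.

Let below_H a m n : (m <= n)%N -> H n (below a m n.+1).
Proof.
move=> /subnK <-; elim: (n - m)%N => [|l IH].
  by rewrite add0n belowS // below_m setTI; exact: V_H.
rewrite belowS ?leq_addl // addSn; apply: H_setI; last exact: V_H.
exact: H_mono.
Qed.

Let below_measurable a m n : measurable (below a m n).
Proof.
by apply: bigcap_measurableType => k _; apply: (@H_measurable k); exact: V_H.
Qed.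

Let V_EFin k : measurable_fun setT (fun t => (V k t)%:E).
Proof. exact/measurable_EFinP. Qed.

Let W_EFin k : measurable_fun setT (fun t => (W k t)%:E).
Proof. exact/measurable_EFinP. Qed.

(* Ville's inequality: the sum of the expectation of V n on the paths that have
   not reached a yet and of a times the probability of the others grows at each
   step by at most C * gamma n ^+ 2. *)
Lemma maximal_inequality (a : R) m n : (0 <= a)%R -> (m <= n)%N ->
  a%:E * P (~` below a m n) <=
    \int[P]_t (V m t)%:E + (C * \sum_(m <= k < n) gamma k ^+ 2)%:E.
Proof.
move=> a0 mn.
suff q : \int[P]_(t in below a m n) (V n t)%:E + a%:E * P (~` below a m n) <=
    \int[P]_t (V m t)%:E + (C * \sum_(m <= k < n) gamma k ^+ 2)%:E.
  apply: le_trans q; rewrite leeDr //.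
  by apply: integral_ge0 => t _; rewrite lee_fin.
move: mn => /subnK <-; elim: (n - m)%N => [|l].
  by rewrite add0n below_m setCT measure0 mule0 big_geq // mulr0.
rewrite addSn; set n' := (l + m)%N => IH.
have mn : (m <= n')%N by rewrite leq_addl.
rewrite big_nat_recr //= mulrDr EFinD addeA.
apply: le_trans (leeD IH (lexx _)).
have mB := below_measurable a m n'.
have mB' := below_measurable a m n'.+1.
have mhit : measurable (below a m n' `\` below a m n'.+1) by exact: measurableD.
have Cn : ~` below a m n'.+1 = ~` below a m n' `|` (below a m n' `\` below a m n'.+1).
  rewrite belowS //; apply/seteqP; split=> t.
    by move=> h; have [bt|] := pselect (below a m n' t); [right|left].
  by move=> [nb [b _]|[_]].
rewrite Cn measureU //; last 2 first.
- exact: measurableC.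
- by apply/seteqP; split=> t // [nb [b _]].
have -> : \int[P]_(t in below a m n') (V n' t)%:E =
   \int[P]_(t in below a m n'.+1) (V n' t)%:E +
   \int[P]_(t in below a m n' `\` below a m n'.+1) (V n' t)%:E.
  rewrite -ge0_integral_setU //.
  - rewrite setDUK // belowS //; exact: subIsetl.
  - exact: measurable_funTS.
  - by move=> t _; rewrite lee_fin.
  - by apply/disj_setPS => t [b [_]].
(* Markov's inequality on the paths leaving at time [n']: their share of the expectation pays for
   the growth of the probability. [step] is then applied only on the paths that remain. *)
have hit : a%:E * P (below a m n' `\` below a m n'.+1) <=
   \int[P]_(t in below a m n' `\` below a m n'.+1) (V n' t)%:E.
  rewrite -integral_cst //; apply: ge0_le_integral => //.
  - exact: measurable_funTS.
  - move=> t [bt]; rewrite belowS // => nb /=; rewrite lee_fin leNgt.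
    by apply/negP => h; apply: nb.
have := step (below_H a mn).
have w0 : 0 <= (gamma n')%:E * \int[P]_(t in below a m n'.+1) (W n' t)%:E.
  apply: mule_ge0; first by rewrite lee_fin ltW.
  by apply: integral_ge0 => t _; rewrite lee_fin.
move=> st; have {}st := le_trans (leeDl _ w0) st.
rewrite ge0_muleDr //.
apply: le_trans (leeD st (leeD (lexx _) hit)) _.
set x1 := \int[P]_(t in _) _; set x2 := _%:E; set x3 := _ * _.
set x4 := \int[P]_(t in _ `\` _) _.
clearbody x1 x2 x3 x4.
by rewrite -!addeA leeD // addeC (addeC x3) -addeA.
Qed.

Let S := limn (series (fun k => gamma k ^+ 2)%R).

Let partial_le n : (\sum_(0 <= k < n) gamma k ^+ 2 <= S)%R.
Proof.
apply: (nondecreasing_cvgn_le _ gamma_sqr).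
by apply: nondecreasing_series => k _ _; rewrite sqr_ge0.
Qed.

Let V_integrable k : P.-integrable setT (fun t => (V k t)%:E).
Proof. by apply: (bounded_integrable P (K := K)) => // t; rewrite V_ge0 V_le. Qed.

Let W_integrable k : P.-integrable setT (fun t => (W k t)%:E).
Proof. by apply: (bounded_integrable P (K := K)) => // t; rewrite W_ge0 W_le. Qed.

Let mean_small (delta : R) m0 : (0 < delta)%R ->
  exists2 m, (m0 <= m)%N & \int[P]_t (V m t)%:E <= delta%:E.
Proof.
move=> d0; pose e k := fine (\int[P]_t (V k t)%:E).
pose w k := fine (\int[P]_t (W k t)%:E).
have eE k : (e k)%:E = \int[P]_t (V k t)%:E.
  by rewrite fineK // integrable_fin_num.
have wE k : (w k)%:E = \int[P]_t (W k t)%:E.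
  by rewrite fineK // integrable_fin_num.
have e0 k : (0 <= e k)%R.
  by rewrite fine_ge0 // integral_ge0 // => t _; rewrite lee_fin.
have w0 k : (0 <= w k)%R.
  by rewrite fine_ge0 // integral_ge0 // => t _; rewrite lee_fin.
clearbody e w.
have ew k : (e k.+1 + gamma k * w k <= e k + C * gamma k ^+ 2)%R.
  by rewrite -lee_fin !EFinD (EFinM (gamma k)) !eE wE; exact: step (H_setT k).
have d2 : (0 < delta / 2)%R by rewrite divr_gt0.
have [D D0 VDW] := V_le_W d2.
(* Half of [delta] is spent on the additive term of [V_le_W], half on [D * w m]; [D + 1] allows for
   [D = 0]. *)
have d3 : (0 < delta / 2 / (D + 1))%R by rewrite divr_gt0 // ltr_wpDl.
have [m mm0 wm] := eventually_small C_ge0 e0 gamma_gt0 partial_le gamma_sum ew m0 d3.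
exists m => //; rewrite -eE lee_fin.
have : (e m <= delta / 2 + D * w m)%R.
  rewrite -lee_fin EFinD (EFinM D) eE wE.
  apply: (@le_trans _ _ (\int[P]_t ((delta / 2)%:E + D%:E * (W m t)%:E))).
    apply: ge0_le_integral => //.
    - by move=> t _; rewrite lee_fin.
    - by apply: emeasurable_funD => //; exact: measurable_funeM.
    - by move=> t _; rewrite -EFinM -EFinD lee_fin.
  rewrite ge0_integralD //; last 3 first.
  - by move=> t _; rewrite lee_fin ltW.
  - by move=> t _; rewrite -EFinM lee_fin mulr_ge0.
  - exact: measurable_funeM.
  rewrite ge0_integralZl_EFin //; last by move=> t _; rewrite lee_fin.
  by rewrite leeD // -[X in X <= _]/(\int[P]_t (cst (delta / 2)%:E t))
    integral_probability_cst.
have : (D * w m <= delta / 2)%R.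
  apply: (@le_trans _ _ ((D + 1) * (delta / 2 / (D + 1)))%R).
    by apply: ler_pM => //; [rewrite lerDl|exact: ltW].
  by rewrite mulrC divfK // gt_eqF // ltr_wpDl.
lra.
Qed.

(** Start the maximal inequality at a time [m] where both the mean of [V m] and the remaining noise
    budget are at most [a * e / 2]. The bound is uniform in [n], so it passes to the increasing
    union. *)
Let above_measure (a e : R) : (0 < a)%R -> (0 < e)%R ->
  exists m, P (\bigcup_n ~` below a m n) <= e%:E.
Proof.
move=> a0 e0.
have ae2 : (0 < a * e / 2)%R by rewrite divr_gt0 // mulr_gt0.
have C1 : (0 < C + 1)%R by rewrite ltr_wpDl.
have [m0 Sm0] : exists m0, forall m, (m0 <= m)%N ->
    (C * (S - \sum_(0 <= k < m) gamma k ^+ 2) <= a * e / 2)%R.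
  have : (series (fun k => gamma k ^+ 2) @ \oo --> S)%R by exact: gamma_sqr.
  move=> /cvgrPdist_le /(_ (a * e / 2 / (C + 1))%R) [|N _ hN].
    by rewrite divr_gt0.
  exists N => m /hN; rewrite /series /= ger0_norm ?subr_ge0 ?partial_le // => h.
  apply: (@le_trans _ _ ((C + 1) * (a * e / 2 / (C + 1)))%R).
    apply: ler_pM => //; first by rewrite subr_ge0 partial_le.
    by rewrite lerDl.
  by rewrite mulrC divfK // gt_eqF.
have [m mm0 Vm] := mean_small m0 ae2.
exists m.
have mb n : measurable (~` below a m n) by exact: measurableC.
have nd : nondecreasing_seq (fun n => ~` below a m n).
  move=> n1 n2 n12; apply/subsetPset; apply: subsetC => t h k /= /andP[mk kn].
  by apply: h; rewrite /= mk (leq_trans kn).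
have cv : P (~` below a m n) @[n --> \oo] --> P (\bigcup_n ~` below a m n).
  exact: nondecreasing_cvg_mu mb (bigcupT_measurable _ mb) nd.
apply: (cvge_to_le cv); near=> n.
have mn : (m <= n)%N by near: n; exact: nbhs_infty_ge.
rewrite -(@lee_pmul2l _ a%:E) ?fin_numE // ?lte_fin //.
apply: le_trans (maximal_inequality (ltW a0) mn) _.
rewrite -EFinM [in leRHS](splitr (a * e)) EFinD leeD // lee_fin.
apply: le_trans (Sm0 _ mm0); rewrite ler_wpM2l //.
rewrite lerBrDl; apply: le_trans (partial_le n).
by rewrite [in leRHS](big_cat_nat (n := m)).
Unshelve. all: by end_near. Qed.

Lemma almost_supermartingale_cvg0 :
  {ae P, forall t, V k t @[k --> \oo] --> 0%R}.
Proof.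
(* The paths on which [V] reaches [q.+1%:R^-1] at arbitrarily late times. *)
pose bad q : set T := \bigcap_m \bigcup_n ~` below q.+1%:R^-1 m n.
have badP q : P.-negligible (bad q).
  have bm m n : measurable (~` below q.+1%:R^-1 m n) by exact: measurableC.
  have mbad : measurable (bad q).
    by apply: bigcapT_measurable => m; exact: bigcupT_measurable.
  apply/negligibleP => //; apply/eqP; rewrite eq_le measure_ge0 andbT.
  apply/lee_addgt0Pr => e e0; rewrite add0e.
  have q0 : (0 < q.+1%:R^-1 :> R)%R by rewrite invr_gt0.
  have [m Pm] := above_measure q0 e0; apply: le_trans Pm.
  rewrite le_measure ?inE //; first exact: bigcupT_measurable.
  by move=> t; apply.
have : P.-negligible (\bigcup_q bad q) by exact: negligible_bigcup.
apply: negligibleS => t /= h; apply: contrapT => nbad; apply: h.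
apply/cvgrPdist_lt => e e0.
have [q _ qe] := @near_infty_natSinv_lt R (PosNum e0).
have : ~ bad q t by move=> b; apply: nbad; exists q.
move=> /existsNP[m /not_implyP[_ nb]].
exists m => // n mn; rewrite /= sub0r normrN ger0_norm //.
apply: lt_trans (qe q (leqnn _)).
have bt : below q.+1%:R^-1 m n.+1 t by apply: contrapT => h; apply: nb; exists n.+1.
by apply: bt; rewrite /= mn ltnSn.
Qed.

End almost_supermartingale.

(** * The algorithm in the sup norm *)

Section blocks.
Context {R : realType} {d : nat} {n : 'I_d -> nat}.
Local Notation N := (\sum_(i < d) n i)%N.
Implicit Types u v : 'rV[R]_N.

Lemma dotv_blocks u v :
  dotv u v = \sum_(i < d) dotv (submxrow u i) (submxrow v i).
Proof.
rewrite /dotv (reindex _ tagnat.rank_bij_on) /= sig_big_dep /=.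
apply: eq_bigr => -[i j] _; rewrite /= !mxE.
by rewrite tagnat.rankE.
Qed.

Lemma ler_norm_submxrow u i : `|submxrow u i| <= `|u|.
Proof. by apply: ler_normP => // j; rewrite mxE ler_coord_norm. Qed.

Lemma ler_norm_blocks u (a : R) : 0 <= a ->
  (forall i, `|submxrow u i| <= a) -> `|u| <= a.
Proof.
move=> a0 ua; apply: ler_normP => // s.
apply: le_trans (ua (tagnat.sig1 s)).
have -> : u 0 s = submxrow u (tagnat.sig1 s) 0 (tagnat.sig2 s).
  by rewrite mxE tagnat.sig2K.
exact: ler_coord_norm.
Qed.

Lemma submxrow_continuous i : continuous (fun u : 'rV[R]_N => submxrow u i).
Proof.
apply: (@lipschitz_continuous _ _ _ _ 1) => u v.
by rewrite mul1r -submxrowB ler_norm_submxrow.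
Qed.

Variable X : forall i, set 'rV[R]_(n i).
Arguments X : clear implicits.

Lemma block_prod_closed : (forall i, closed (X i)) -> closed (block_prod X).
Proof.
move=> cX; have -> : block_prod X =
    \bigcap_(i in [set: 'I_d]) (fun u : 'rV[R]_N => submxrow u i) @^-1` X i.
  by apply/seteqP; split=> u h i; [move=> _; exact: h|exact: h].
apply: closed_bigI => i _; apply: closed_comp => // u _.
exact: submxrow_continuous.
Qed.

Lemma block_prod_compact : (forall i, compact (X i)) -> compact (block_prod X).
Proof.
move=> kX; apply: bounded_closed_compact.
  have bX i : exists2 b : R, 0 < b & forall z, X i z -> `|z| < b.
    have [b b0 hb] := ex_strict_bound_gt0 (compact_bounded (kX i)).
    by exists b.
  pose b i := s2val (cid2 (bX i)).
  have b0 i : 0 < b i by rewrite /b; case: (cid2 _).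
  have bP i z : X i z -> `|z| < b i by rewrite /b; case: (cid2 _) => ? /= _; exact.
  exists (\sum_i b i); split; first by rewrite num_real.
  move=> M bM u Xu; apply: ler_norm_blocks => [|i].
    by rewrite ltW // (le_lt_trans _ bM) // sumr_ge0 // => i _; rewrite ltW ?b0.
  apply: le_trans (ltW (bP i _ (Xu i))) _; apply: le_trans (ltW bM).
  by rewrite (bigD1 i) //= lerDl sumr_ge0 // => j _; rewrite ltW ?b0.
by apply: block_prod_closed => i; exact: compact_closed.
Qed.

Lemma block_prod_segment_closed :
  (forall i, segment_closed (X i)) -> segment_closed (block_prod X).
Proof.
move=> cX u v t Xu Xv t0 t1 i.
have -> : submxrow (t *: u + (1 - t) *: v) i =
          t *: submxrow u i + (1 - t) *: submxrow v i.
  by apply/rowP => j; rewrite !mxE.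
exact: cX.
Qed.

Lemma block_prod_nonempty : (forall i, X i !=set0) -> block_prod X !=set0.
Proof.
move=> X0; exists (\mxrow_i (sval (cid (X0 i)))) => i.
by rewrite mxrowK; case: cid.
Qed.

End blocks.

(** * Descent inequality for one drawn block *)

Section descent.
Context {R : realType} {d : nat} {n : 'I_d -> nat}.
Local Notation N := (\sum_(i < d) n i)%N.
Variables (X : forall i, set 'rV[R]_(n i))
  (w : forall i, 'rV[R]_(n i) -> R) (g : forall i, 'rV[R]_(n i) -> 'rV[R]_(n i))
  (m M : 'I_d -> R).
Arguments X : clear implicits.
Arguments w : clear implicits.
Arguments g : clear implicits.
Local Notation BX := (block_prod X).
Hypotheses (X0 : forall i, X i !=set0) (X_cpt : forall i, compact (X i))
  (X_cvx : forall i, segment_closed (X i))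
  (m_gt0 : forall i, 0 < m i)
  (w_cont : forall i, {within X i, continuous (w i)})
  (w_ge : forall i u v, X i u -> X i v ->
     m i / 2 * `|u - v| ^+ 2 <= bregman (w i) (g i) u v)
  (w_le : forall i u v, X i u -> X i v ->
     bregman (w i) (g i) u v <= M i / 2 * `|u - v| ^+ 2).
Variables (F : 'rV[R]_N -> 'rV[R]_N) (L : 'I_d -> R).
Hypotheses (F_cont : {within BX, continuous F}) (L_ge0 : forall i, 0 <= L i)
  (F_lip : forall (i : 'I_d) u v, BX u -> BX v ->
     (forall j, j != i -> submxrow u j = submxrow v j) ->
     `|submxrow (F u) i - submxrow (F v) i| <= L i * `|submxrow u i - submxrow v i|).
Variables (p : 'I_d -> R) (p_gt0 : forall i, 0 < p i).
Variables (xs : 'rV[R]_N) (BXxs : BX xs).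
Variables (D : R) (X_diam : forall i u v, X i u -> X i v -> `|u - v| <= D).

(** The weight of a block cancels the probability of drawing it, so the mean decrease is the full
    gap and not a weighted sum of block gaps. *)
Definition lyapunov (x : 'rV[R]_N) : R :=
  \sum_i (p i)^-1 * bregman (w i) (g i) (submxrow x i) (submxrow xs i).

Definition block_gap i (x : 'rV[R]_N) : R :=
  dotv (submxrow (F x) i) (submxrow x i - submxrow xs i).

Lemma sum_block_gap x : \sum_i block_gap i x = dotv (F x) (x - xs).
Proof. by rewrite dotv_blocks; apply: eq_bigr => i _; rewrite submxrowB. Qed.

Let D_ge0 (i : 'I_d) : 0 <= D.
Proof.
have [u Xu] := X0 i; apply: le_trans (X_diam Xu Xu).
by rewrite subrr normr0.
Qed.

(** The first term comes from [prox_descent]. The second is the cost of extrapolating: dimension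
    factor, block Lipschitz constant, displacement constant of [prox_dist], diameter. *)
Definition descent_rate i : R :=
  (p i)^-1 * ((n i)%:R ^+ 2 / (2 * m i) +
              (n i)%:R * L i * ((n i)%:R / m i) * D).

Lemma descent_rate_ge0 i : 0 <= descent_rate i.
Proof.
have mi := m_gt0 i.
apply: mulr_ge0; first by rewrite invr_ge0 ltW.
apply: addr_ge0.
  by rewrite divr_ge0 ?sqr_ge0 // mulr_ge0 // ltW.
by rewrite !mulr_ge0 ?(D_ge0 i) // invr_ge0 ltW.
Qed.

(* Block i was drawn at x; a and b are the values of the oracle used for the
   extrapolated point y and for the new iterate x'. *)
Lemma block_descent (c : R) (x y x' a b : 'rV[R]_N) (i : 'I_d) : 0 < c -> BX x ->
  (forall j, submxrow y j = if j == i
     then prox (X j) (w j) (g j) (submxrow x j) (c *: submxrow a j)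
     else submxrow x j) ->
  (forall j, submxrow x' j = if j == i
     then prox (X j) (w j) (g j) (submxrow x j) (c *: submxrow b j)
     else submxrow x j) ->
  lyapunov x' <= lyapunov x - c * ((p i)^-1 * block_gap i x)
    - c * ((p i)^-1 * dotv (submxrow b i - submxrow (F y) i)
                           (submxrow x i - submxrow xs i))
    + c ^+ 2 * (descent_rate i * (1 + `|a| ^+ 2 + `|b| ^+ 2)).
Proof.
move=> c0 Xx yE x'E.
have mi := m_gt0 i.
have yi := yE i; have x'i := x'E i; rewrite eqxx in yi x'i.
have BXy : BX y.
  by move=> j; rewrite yE; case: eqP => // _; apply: prox_in => //; exact: w_cont.
rewrite /lyapunov (bigD1 i) //= [in leRHS](bigD1 i) //=.
under eq_bigr => j ji do rewrite x'E (negPf ji).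
set rest := \sum_(_ | _) _.
have desc := prox_descent (X0 i) (@X_cpt i) (@X_cvx i) (m_gt0 i) (@w_cont i)
   (@w_ge i) (@w_le i) (c *: submxrow b i) (Xx i) (BXxs i).
rewrite -x'i in desc.
have dist := prox_dist (X0 i) (@X_cpt i) (@X_cvx i) (m_gt0 i) (@w_cont i)
   (@w_ge i) (@w_le i) (c *: submxrow a i) (Xx i).
rewrite -yi in dist.
set e := submxrow x i - submxrow xs i in desc *.
have e_le : `|e| <= D by exact: X_diam.
(* Gap at [x], effect of the extrapolation, oracle error at [y]. *)
have split_b : dotv (submxrow b i) e = block_gap i x
   + dotv (submxrow (F y) i - submxrow (F x) i) e
   + dotv (submxrow b i - submxrow (F y) i) e.
  by rewrite /block_gap -/e !dotvBl; ring.
(* [y] differs from [x] only in block [i], which is exactly the situation covered by the blockwise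
   Lipschitz bound. *)
have lip : - dotv (submxrow (F y) i - submxrow (F x) i) e <=
    (n i)%:R * L i * ((n i)%:R / m i) * D * (c * `|a|).
  rewrite -dotvNl; apply: le_trans (ler_norm _) (le_trans (ler_norm_dotv _ _) _).
  rewrite normrN.
  have h1 : `|submxrow (F y) i - submxrow (F x) i| <=
            L i * ((n i)%:R / m i * (c * `|a|)).
    apply: le_trans (F_lip BXy Xx _) _.
      by move=> j ji; rewrite yE (negPf ji).
    rewrite ler_wpM2l //; apply: le_trans dist _.
    apply: ler_wpM2l; first by rewrite divr_ge0 // ltW.
    rewrite normrZ (gtr0_norm c0) ler_pM2l //.
    exact: ler_norm_submxrow.
  apply: le_trans (ler_wpM2r _ (ler_wpM2l _ h1)) _ => //.
  apply: le_trans (ler_wpM2l _ e_le) _.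
    by rewrite !mulr_ge0 ?L_ge0 ?invr_ge0 ?(ltW mi) ?(ltW c0).
  by rewrite le_eqVlt; apply/orP; left; apply/eqP; ring.
have bb : `|c *: submxrow b i| ^+ 2 <= c ^+ 2 * `|b| ^+ 2.
  by rewrite normrZ gtr0_norm // exprMn ler_pM2l ?exprn_gt0 // lerXn2r ?nnegrE // ler_norm_submxrow.
(* The extrapolation cost is linear in the norm of [a], whereas only second moments are
   controlled. *)
have aa : `|a| <= 1 + `|a| ^+ 2 by have := sqr_ge0 (`|a| - 1 / 2); lra.
set K1 := (n i)%:R ^+ 2 / (2 * m i) in desc *.
have K10 : 0 <= K1 by rewrite divr_ge0 ?sqr_ge0 // mulr_ge0 // ltW.
set K2 := (n i)%:R * L i * ((n i)%:R / m i) * D in lip *.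
have K20 : 0 <= K2 by rewrite !mulr_ge0 ?L_ge0 ?(D_ge0 i) ?invr_ge0 ?(ltW mi).
set q := (p i)^-1; have q0 : 0 < q by rewrite invr_gt0.
rewrite dotvZl split_b in desc.
move: desc; set B' := bregman _ _ (submxrow x' i) _; set B0 := bregman _ _ (submxrow x i) _.
move=> desc.
have main : B' <= B0 - c * block_gap i x
     - c * dotv (submxrow b i - submxrow (F y) i) e
     + c ^+ 2 * ((K1 + K2) * (1 + `|a| ^+ 2 + `|b| ^+ 2)).
  have := ler_wpM2l K10 bb.
  have := ler_wpM2l (ltW c0) lip.
  have := ler_wpM2l (mulr_ge0 K20 (sqr_ge0 c)) aa.
  have := mulr_ge0 (mulr_ge0 K20 (sqr_ge0 c)) (sqr_ge0 `|b|).
  have := mulr_ge0 (mulr_ge0 K10 (sqr_ge0 c)) (sqr_ge0 `|a|).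
  have := mulr_ge0 K10 (sqr_ge0 c).
  lra.
have := ler_wpM2l (ltW q0) main; rewrite /descent_rate -/K1 -/K2 -/q; lra.
Qed.

(** * The Lyapunov function against the distance and the gap *)

Let bregman_term_ge0 x i : BX x ->
  0 <= (p i)^-1 * bregman (w i) (g i) (submxrow x i) (submxrow xs i).
Proof.
move=> Xx; apply: mulr_ge0; first by rewrite invr_ge0 ltW.
apply: (le_trans _ (w_ge (Xx i) (BXxs i))).
by apply: mulr_ge0; rewrite ?sqr_ge0 // divr_ge0 // ltW.
Qed.

Lemma bregman_lyapunov x i : BX x ->
  (p i)^-1 * bregman (w i) (g i) (submxrow x i) (submxrow xs i) <= lyapunov x.
Proof.
move=> Xx; rewrite /lyapunov (bigD1 i) //= lerDl sumr_ge0 // => j _.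
exact: bregman_term_ge0.
Qed.

Lemma lyapunov_ge0 x : BX x -> 0 <= lyapunov x.
Proof.
by move=> Xx; apply: sumr_ge0 => i _; exact: bregman_term_ge0.
Qed.

Lemma lyapunov_small (e : R) : 0 < e ->
  exists2 delta, 0 < delta & forall x, BX x -> lyapunov x < delta -> `|x - xs| <= e.
Proof.
(* The constant that strong convexity yields in bounding the squared distance of block [i] by the
   Lyapunov function. *)
move=> e0; pose c i := p i * (2 / m i).
have c0 i : 0 < c i by rewrite mulr_gt0 // divr_gt0.
have sc0 : 0 < \sum_i c i + 1 by rewrite ltr_wpDl // sumr_ge0 // => i _; exact: ltW.
exists (e ^+ 2 / (\sum_i c i + 1)); first by rewrite divr_gt0 // exprn_gt0.
move=> x Xx Vx; apply: ler_norm_blocks => [|i]; first exact: ltW.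
rewrite submxrowB -ler_sqr ?nnegrE // ?(ltW e0) //.
have h1 := w_ge (Xx i) (BXxs i); have h2 := bregman_lyapunov i Xx.
have h3 : `|submxrow x i - submxrow xs i| ^+ 2 <= c i * lyapunov x.
  have : m i / 2 * `|submxrow x i - submxrow xs i| ^+ 2 <= p i * lyapunov x.
    by apply: le_trans h1 _; rewrite -ler_pdivrMl.
  rewrite -ler_pdivlMl ?divr_gt0 // => h; apply: le_trans h _.
  by rewrite invf_div /c; nra.
apply: le_trans h3 _; apply: (@le_trans _ _ ((\sum_i c i + 1) * lyapunov x)).
  rewrite ler_wpM2r ?lyapunov_ge0 // (bigD1 i) //= -addrA lerDl.
  by rewrite addr_ge0 // sumr_ge0 // => j _; exact: ltW.
by rewrite -ler_pdivlMl // mulrC ltW.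
Qed.

Hypothesis M_ge0 : forall i, 0 <= M i.

Lemma lyapunov_le x : BX x ->
  lyapunov x <= (\sum_i (p i)^-1 * (M i / 2)) * `|x - xs| ^+ 2.
Proof.
move=> Xx; rewrite mulr_suml; apply: ler_sum => i _.
rewrite -mulrA ler_pM2l ?invr_gt0 //.
apply: le_trans (w_le (Xx i) (BXxs i)) _.
rewrite ler_wpM2l ?divr_ge0 // lerXn2r ?nnegrE //.
by rewrite -submxrowB ler_norm_submxrow.
Qed.

Let BX_cpt : compact BX. Proof. exact: block_prod_compact. Qed.
Let BX0 : BX !=set0. Proof. by exists xs. Qed.

Lemma within_bounded (f : 'rV[R]_N -> R) : {within BX, continuous f} ->
  exists2 b, 0 <= b & forall x, BX x -> f x <= b.
Proof.
move=> fc; have [c Bc hc] := compact_EVT_max BX0 BX_cpt fc.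
exists `|f c| => // x Xx; apply: le_trans (ler_norm _); apply: hc.
by rewrite inE.
Qed.

Lemma gap_cont : {within BX, continuous (fun x => dotv (F x) (x - xs))}.
Proof.
apply/subspace_continuousP => x Xx; apply: cvg_dotv.
  by move/subspace_continuousP: F_cont; apply.
apply: cvg_within_filter; apply: cvgB; [exact: cvg_id|exact: cvg_cst].
Qed.

Lemma iterate_bound : exists2 K, 0 <= K & forall x, BX x ->
  [/\ lyapunov x <= K, dotv (F x) (x - xs) <= K & `|F x| <= K].
Proof.
have [b1 b10 h1] := within_bounded gap_cont.
have [b2 b20 h2] : exists2 b, 0 <= b & forall x, BX x -> `|F x| <= b.
  apply: within_bounded; apply/subspace_continuousP => x Xx.
  by apply: cvg_norm; move/subspace_continuousP: F_cont; apply.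
have [b3 b30 h3] : exists2 b, 0 <= b & forall x, BX x -> `|x - xs| <= b.
  apply: within_bounded; apply/subspace_continuousP => x Xx.
  apply: cvg_norm; apply: cvg_within_filter.
  by apply: cvgB; [exact: cvg_id|exact: cvg_cst].
set c := \sum_i (p i)^-1 * (M i / 2).
have c0 : 0 <= c.
  by apply: sumr_ge0 => i _; rewrite mulr_ge0 ?invr_ge0 ?divr_ge0 // ltW.
exists (c * b3 ^+ 2 + b1 + b2).
  by rewrite !addr_ge0 // mulr_ge0 // sqr_ge0.
have cb : 0 <= c * b3 ^+ 2 by rewrite mulr_ge0 // sqr_ge0.
move=> x Xx; split.
- apply: le_trans (lyapunov_le Xx) _; rewrite -/c -addrA.
  apply: (@le_trans _ _ (c * b3 ^+ 2)); last by rewrite lerDl addr_ge0.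
  by rewrite ler_wpM2l // lerXn2r ?nnegrE // h3.
- by apply: le_trans (h1 _ Xx) _; lra.
- by apply: le_trans (h2 _ Xx) _; lra.
Qed.

Hypotheses (F_pseudo : strictly_pseudomonotone BX F)
  (xs_VI : VI_solution BX F xs).

Lemma gap_gt0 x : BX x -> x <> xs -> 0 < dotv (F x) (x - xs).
Proof. by move=> Xx xxs; apply: F_pseudo => //; have [_] := xs_VI; apply. Qed.

Lemma gap_ge0 x : BX x -> 0 <= dotv (F x) (x - xs).
Proof.
move=> Xx; have [->|/eqP xxs] := eqVneq x xs; first by rewrite subrr dotv0r.
exact/ltW/gap_gt0.
Qed.

(** Near [xs] the quadratic upper bound makes the Lyapunov function at most [e]. Away from it, on a
    compact set, the gap has a positive minimum, so a multiple of the gap exceeds the bound [K] of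
    the Lyapunov function. *)
Lemma lyapunov_le_gap (e : R) : 0 < e -> exists2 c, 0 <= c &
  forall x, BX x -> lyapunov x <= e + c * dotv (F x) (x - xs).
Proof.
move=> e0; set c := \sum_i (p i)^-1 * (M i / 2).
have c0 : 0 <= c.
  by apply: sumr_ge0 => i _; rewrite mulr_ge0 ?invr_ge0 ?divr_ge0 // ltW.
have c10 : 0 < c + 1 by rewrite ltr_wpDl.
(* [r <= 1] gives [r ^+ 2 <= r], whence [c * r ^+ 2 <= e]. *)
pose r := Num.min 1 (e / (c + 1)).
have r0 : 0 < r by rewrite lt_min ltr01 divr_gt0.
have cr : c * r ^+ 2 <= e.
  apply: (@le_trans _ _ ((c + 1) * (e / (c + 1)))); last first.
    by rewrite mulrC divfK // gt_eqF.
  rewrite ler_pM ?sqr_ge0 ?lerDl // (le_trans (y := r)) //.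
    by rewrite -[leRHS]mulr1 expr2 ler_wpM2l ?(ltW r0) // ge_min lexx.
  by rewrite ge_min lexx orbT.
pose far := BX `&` [set x | r <= `|x - xs|].
have far_cpt : compact far.
  apply: compact_closedI => //.
  apply: (@closed_comp _ _ (fun x : 'rV[R]_N => `|x - xs|) [set a | r <= a]).
    move=> x _; apply: (@cvg_norm _ _ _ (nbhs x)).
    by apply: cvgB; [exact: cvg_id|exact: cvg_cst].
  exact: closed_ge.
have near_le x : BX x -> `|x - xs| < r -> lyapunov x <= e.
  move=> Xx xr; apply: le_trans (lyapunov_le Xx) (le_trans _ cr).
  by rewrite ler_wpM2l // lerXn2r ?nnegrE // ltW.
have [f0|/set0P f0] := eqVneq far set0.
  exists 0 => // x Xx; rewrite mul0r addr0; apply: near_le => //.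
  rewrite ltNge; apply/negP => h; have : far x by [].
  by rewrite f0.
have [z /[!inE] -[Xz rz] hz] := compact_EVT_min f0 far_cpt
  (continuous_subspaceW (@subIsetl _ _ _) gap_cont).
have gz : 0 < dotv (F z) (z - xs).
  apply: gap_gt0 => // zxs; move: rz; rewrite /= zxs subrr normr0.
  by rewrite leNgt r0.
have [K K0 hK] := iterate_bound.
exists (K / dotv (F z) (z - xs)) => [|x Xx]; first by rewrite divr_ge0 // ltW.
have [xr|rx] := ltP `|x - xs| r.
  apply: le_trans (near_le _ Xx xr) _; rewrite lerDl mulr_ge0 ?gap_ge0 //.
  by rewrite divr_ge0 // ltW.
have [VK _ _] := hK _ Xx; apply: le_trans VK _.
apply: (@le_trans _ _ (K / dotv (F z) (z - xs) * dotv (F x) (x - xs))).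
  rewrite mulrAC -mulrA -[leLHS]mulr1 ler_wpM2l // ler_pdivlMr // mul1r.
  by apply: hz; rewrite inE.
by rewrite lerDr ltW.
Qed.

(** * Measurability of prox steps *)

Hypothesis g_cont : forall i, {within X i, continuous (g i)}.

Let X_closed i : closed (X i).
Proof. by apply: compact_closed. Qed.

Let BX_closed : closed BX. Proof. exact: block_prod_closed. Qed.

Lemma measurable_submxrow dU (U : measurableType dU) i (f : U -> 'rV[R]_N) :
  measurable_fun setT (f : U -> borelV R N) ->
  measurable_fun setT ((fun t => submxrow (f t) i) : U -> borelV R (n i)).
Proof.
move=> mf; apply: measurable_borelV => j.
under eq_fun do rewrite mxE.
exact: (measurableT_comp (measurable_coord _) mf).
Qed.

Lemma measurable_prox dU (U : measurableType dU) i (f h : U -> 'rV[R]_(n i)) :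
  (forall t, X i (f t)) ->
  measurable_fun setT (f : U -> borelV R (n i)) ->
  measurable_fun setT (h : U -> borelV R (n i)) ->
  measurable_fun setT
    ((fun t => prox (X i) (w i) (g i) (f t) (h t)) : U -> borelV R (n i)).
Proof.
move=> Xf mf mh; under eq_fun do rewrite prox_tilted.
pose q t := h t - g i (f t).
have mq : measurable_fun setT (q : U -> borelV R (n i)).
  apply: measurable_borelV => j; under eq_fun do rewrite !mxE.
  apply: measurable_funB; first exact: (measurableT_comp (measurable_coord _) mh).
  have mg : measurable_fun (X i : set (borelV R (n i))) (g i : borelV R _ -> borelV R _).
    exact: continuous_borelV (@X_closed i) (@g_cont i).
  have mgf : measurable_fun setT (g i \o f : U -> borelV R (n i)).
    apply: (measurable_comp _ _ mg mf).
      exact: measurable_closed_borelV (@X_closed i).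
    by move=> _ [t _ <-]; exact: Xf.
  exact: (measurableT_comp (measurable_coord _) mgf).
have mt : measurable_fun setT (tilted_argmin (X i) (w i) : borelV R _ -> borelV R _).
  apply: continuous_borelV; first exact: closedT.
  apply: continuous_subspaceT.
  exact: (tilted_argmin_continuous (X0 i) (@X_cpt i) (@X_cvx i) (m_gt0 i) (@w_cont i)
    (@w_ge i) (@w_le i)).
exact: (measurableT_comp mt mq).
Qed.

(** The domain is an arbitrary measurable space, so that the lemma applies to [T] with the
    sigma-algebra of each history. It serves for the extrapolation and for the update. *)
Lemma measurable_block_step dU (U : measurableType dU) (c : R)
    (f h f' : U -> 'rV[R]_N) (j : U -> 'I_d) :
  (forall t, BX (f t)) ->
  measurable_fun setT (f : U -> borelV R N) ->
  measurable_fun setT (h : U -> borelV R N) ->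
  (forall i, measurable_fun setT (fun t => i == j t)) ->
  (forall t i, submxrow (f' t) i = if i == j t
     then prox (X i) (w i) (g i) (submxrow (f t) i) (c *: submxrow (h t) i)
     else submxrow (f t) i) ->
  measurable_fun setT (f' : U -> borelV R N).
Proof.
move=> BXf mf mh mj f'E; apply: measurable_borelV => s.
have -> : (fun t => f' t 0 s) = fun t => submxrow (f' t) (tagnat.sig1 s) 0 (tagnat.sig2 s).
  by apply/funext => t; rewrite mxE tagnat.sig2K.
move: (tagnat.sig1 s) (tagnat.sig2 s) => i l.
have mfi := measurable_submxrow (i := i) mf.
have mhi := measurable_submxrow (i := i) mh.
have mch : measurable_fun setT ((fun t => c *: submxrow (h t) i) : U -> borelV R (n i)).
  apply: measurable_borelV => l'; under eq_fun do rewrite mxE.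
  apply: measurable_funM => //.
  exact: (measurableT_comp (measurable_coord _) mhi).
under eq_fun => t do rewrite f'E (fun_if (fun v : 'rV[R]_(n i) => v 0 l)).
apply: measurable_fun_ifT => //.
- have mp := measurable_prox (fun t => BXf t i) mfi mch.
  exact: (measurableT_comp (measurable_coord _) mp).
- exact: (measurableT_comp (measurable_coord _) mfi).
Qed.

Lemma lyapunov_cont : {within BX, continuous lyapunov}.
Proof.
apply/subspace_continuousP => x Xx; rewrite /lyapunov.
apply: cvg_big => [|i _]; first exact: add_continuous.
have xi : submxrow z i @[z --> within BX (nbhs x)] --> submxrow x i.
  by apply: cvg_within_filter; exact: submxrow_continuous.
have Xz : \forall z \near within BX (nbhs x), X i (submxrow z i).
  by rewrite near_withinE; near=> z => /(_ i).
have wz : w i (submxrow z i) @[z --> within BX (nbhs x)] --> w i (submxrow x i).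
  by apply: within_cvg Xz xi; [exact: w_cont|exact: Xx].
have gz : g i (submxrow z i) @[z --> within BX (nbhs x)] --> g i (submxrow x i).
  by apply: within_cvg Xz xi; [exact: g_cont|exact: Xx].
apply: cvgM; first exact: cvg_cst.
apply: cvgB; first by apply: cvgB => //; exact: cvg_cst.
by apply: cvg_dotv => //; apply: cvgB => //; exact: cvg_cst.
Unshelve. all: by end_near. Qed.

Lemma measurable_within dU (U : measurableType dU) (h : 'rV[R]_N -> R) (f : U -> 'rV[R]_N) :
  {within BX, continuous h} ->
  (forall t, BX (f t)) -> measurable_fun setT (f : U -> borelV R N) ->
  measurable_fun setT (fun t => h (f t)).
Proof.
move=> hc BXf mf; have mh := continuous_borelV_real BX_closed hc.
apply: (measurable_comp _ _ mh mf); first exact: measurable_closed_borelV.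
by move=> _ [t _ <-].
Qed.

(** * The random iterates and their histories *)

Context (dT : measure_display) (T : measurableType dT) (P : probability T R).
Variables (m0 : nat) (Fs : 'rV[R]_N -> 'rV[R]_m0 -> 'rV[R]_N).
Variables (gamma : nat -> R) (xis xits : nat -> {RV P >-> borelV R m0}).
Variables (ib : nat -> T -> 'I_d) (x y : nat -> T -> 'rV[R]_N).
Hypothesis Fs_meas : measurable_fun
  ((BX : set (borelV R N)) `*` [set: borelV R m0])
  (fun z : borelV R N * borelV R m0 => (Fs z.1 z.2 : borelV R N)).
Hypotheses (gamma_gt0 : forall k, 0 < gamma k)
  (ib_meas : forall k i, measurable (ib k @^-1` [set i]))
  (x0_meas : measurable_fun setT (x 0%N : T -> borelV R N))
  (xy_BSMP : BSMP X w g Fs gamma (fun k => xis k) (fun k => xits k) ib x y).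

Local Notation events :=
  (source_events (x 0%N) (fun k => xis k) (fun k => xits k) ib).

Hypothesis events_indep : mutually_independent P events.

Lemma iterate_in k t : BX (x k t).
Proof.
elim: k => [|k IH]; first by have [] := xy_BSMP.1 t.
move=> i; have [_ ->] := xy_BSMP.2 k t i; case: ifP => _ //.
by apply: prox_in => //; exact: w_cont.
Qed.

Lemma extrapolation_in k t : BX (y k.+1 t).
Proof.
move=> i; have [-> _] := xy_BSMP.2 k t i; case: ifP => _; last exact: iterate_in.
by apply: prox_in => //; exact: w_cont.
Qed.

Let preimage_system_measurable dU (U : measurableType dU) (f : T -> U) A :
  measurable_fun setT f -> preimage_set_system setT f measurable A -> measurable A.
Proof. by move=> mf [B mB <-]; exact: mf. Qed.

Lemma events_measurable s A : events s A -> measurable A.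
Proof.
case: s => [|k|k|k] /=.
- exact: preimage_system_measurable.
- by apply: preimage_system_measurable; exact: measurable_funPT.
- by apply: preimage_system_measurable; exact: measurable_funPT.
- move=> [B _ <-]; rewrite setTI.
  rewrite (_ : _ @^-1` B = \bigcup_(i in B) (ib k @^-1` [set i])); last first.
    by apply/seteqP; split=> [t Bt|t [i Bi /= e]]; [exists (ib k t)|rewrite /= e].
  by apply: fin_bigcup_measurable.
Qed.

Lemma events_setT s : events s setT.
Proof. by case: s => [|k|k|k]; exists setT => //; rewrite setTI preimage_setT. Qed.

Lemma events_setI s : setI_closed (events s).
Proof.
case: s => [|k|k|k] /= _ _ [A mA <-] [B mB <-]; exists (A `&` B) => //;
  rewrite ?preimage_setI ?setTI //; exact: measurableI.
Qed.

Definition past k : set source := fun s =>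
  match s with
  | InitPoint => True
  | Sample j => (j < k)%N
  | SampleTilde j => (j < k)%N
  | BlockIndex j => (j < k)%N
  end.

(** What [y k.+1] depends on. Of the sources of step [k] only [Sample k] is left out, so that
    [xis k] is still fresh. *)
Definition past_extrapolation k : set source :=
  past k `|` [set SampleTilde k] `|` [set BlockIndex k].

(* T with the sigma-algebra generated by the sources in S *)
Local Notation TH S := (g_sigma_algebraType (history events S)).

Lemma history_sub S S' : S `<=` S' ->
  <<s history events S >> `<=` <<s history events S' >>.
Proof.
move=> SS'; apply: smallest_sub; first exact: smallest_sigma_algebra.
by move=> A [s Ss sA]; apply: sub_gen_smallest; exists s => //; exact: SS'.
Qed.

Lemma measurable_history_sub dU (U : measurableType dU) S S' (f : T -> U) :
  S `<=` S' -> measurable_fun setT (f : TH S -> U) ->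
  measurable_fun setT (f : TH S' -> U).
Proof.
by move=> SS' mf _ B mB; apply: (history_sub SS'); exact: mf.
Qed.

Lemma measurable_history_source dU (U : measurableType dU) S s (f : T -> U) :
  S s -> preimage_set_system setT f measurable `<=` events s ->
  measurable_fun setT (f : TH S -> U).
Proof.
move=> Ss fs _ B mB; apply: sub_gen_smallest; exists s => //.
by apply: fs; exists B.
Qed.

Lemma measurable_history_index S k i : S (BlockIndex k) ->
  measurable_fun setT ((fun t => i == ib k t) : TH S -> bool).
Proof.
move=> Sk; apply: (measurable_fun_bool true) => //.
apply: sub_gen_smallest; exists (BlockIndex k) => //=.
by exists [set j | (i == j) = true].
Qed.

Lemma measurable_oracle dU (U : measurableType dU) (z : U -> 'rV[R]_N)
    (u : U -> borelV R m0) :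
  (forall t, BX (z t)) -> measurable_fun setT (z : U -> borelV R N) ->
  measurable_fun setT u ->
  measurable_fun setT ((fun t => Fs (z t) (u t)) : U -> borelV R N).
Proof.
move=> BXz mz mu.
apply: (@measurable_comp _ _ _ _ _ _ _ _ setT
  (fun t => (z t, u t) : borelV R N * borelV R m0) _ _ Fs_meas).
- by apply: measurableX => //; exact: measurable_closed_borelV.
- by move=> _ [t _ <-]; split=> //; exact: BXz.
- exact: measurable_fun_pair.
Qed.

Lemma past_extrapolation_sub k : past k `<=` past_extrapolation k.
Proof. by move=> s hs; left; left. Qed.

Lemma past_extrapolation_subS k : past_extrapolation k `<=` past k.+1.
Proof.
move=> s [[|->]|->] /=; rewrite ?ltnSn //.
by case: s => //= j jk; rewrite ltnS ltnW.
Qed.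

Lemma measurable_extrapolation k :
  measurable_fun setT (x k : TH (past k) -> borelV R N) ->
  measurable_fun setT (y k.+1 : TH (past_extrapolation k) -> borelV R N).
Proof.
move=> mx; have mx' := measurable_history_sub (@past_extrapolation_sub k) mx.
have mxi : measurable_fun setT (xits k : TH (past_extrapolation k) -> borelV R m0).
  by apply: (@measurable_history_source _ _ _ (SampleTilde k)) => //; left; right.
apply: (@measurable_block_step _ (TH (past_extrapolation k)) (gamma k) (x k)
  (fun t => Fs (x k t) (xits k t)) (y k.+1) (ib k)) => //.
- exact: iterate_in.
- exact: (@measurable_oracle _ (TH (past_extrapolation k)) (x k) (xits k)
    (@iterate_in k) mx' mxi).
- by move=> i; apply: measurable_history_index; right.
- by move=> t i; have [] := xy_BSMP.2 k t i.
Qed.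

Lemma measurable_iterate k :
  measurable_fun setT (x k : TH (past k) -> borelV R N).
Proof.
elim: k => [|k IH].
  by apply: (@measurable_history_source _ _ _ InitPoint).
have my := measurable_history_sub (@past_extrapolation_subS k)
  (measurable_extrapolation IH).
have mx : measurable_fun setT (x k : TH (past k.+1) -> borelV R N).
  apply: measurable_history_sub IH.
  exact: subset_trans (@past_extrapolation_sub k) (@past_extrapolation_subS k).
have mxi : measurable_fun setT (xis k : TH (past k.+1) -> borelV R m0).
  by apply: (@measurable_history_source _ _ _ (Sample k)) => //=.
apply: (@measurable_block_step _ (TH (past k.+1)) (gamma k) (x k)
  (fun t => Fs (y k.+1 t) (xis k t)) (x k.+1) (ib k)) => //.
- exact: iterate_in.
- exact: (@measurable_oracle _ (TH (past k.+1)) (y k.+1) (xis k)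
    (@extrapolation_in k) my mxi).
- by move=> i; apply: measurable_history_index => /=.
- by move=> t i; have [] := xy_BSMP.2 k t i.
Qed.

(** * Zero-mean noise and moment bounds *)

Variable sigma2 : R.
Hypotheses
  (oracle_mean : forall k z s, BX z ->
     (\int[P]_t (Fs z (xis k t) 0 s)%:E = (F z 0 s)%:E)%E)
  (oracle_sqr : forall k z, BX z ->
     (\int[P]_t (`|Fs z (xis k t)| ^+ 2)%:E <= sigma2%:E)%E)
  (oracle_sqr_extrapolation : forall k z, BX z ->
     (\int[P]_t (`|Fs z (xits k t)| ^+ 2)%:E <= sigma2%:E)%E)
  (block_prob : forall i k, P (ib k @^-1` [set i]) = (p i)%:E).

Let history_events_measurable S A : <<s history events S >> A -> measurable A.
Proof. exact: (history_measurable events_measurable). Qed.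

Let source_indep S s dU (U : measurableType dU) (f : T -> U) A B : ~ S s ->
  preimage_set_system setT f measurable `<=` events s ->
  <<s history events S >> A -> measurable B ->
  (P (A `&` f @^-1` B) = P A * P (f @^-1` B))%E.
Proof.
move=> Ss fs SA mB.
apply: (history_indep events_measurable events_setT events_setI events_indep Ss SA).
by apply: fs; exists B => //; rewrite setTI.
Qed.

Lemma sample_indep k A B : <<s history events (past_extrapolation k) >> A ->
  measurable B -> (P (A `&` xis k @^-1` B) = P A * P (xis k @^-1` B))%E.
Proof.
apply: (@source_indep _ (Sample k)) => //.
by move=> [[/=|//]|//]; rewrite ltnn.
Qed.

Lemma sample_extrapolation_indep k A B : <<s history events (past k) >> A ->
  measurable B -> (P (A `&` xits k @^-1` B) = P A * P (xits k @^-1` B))%E.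
Proof.
apply: (@source_indep _ (SampleTilde k)) => //.
by rewrite /= ltnn.
Qed.

Let index_measurable k i : measurable_fun setT (fun t => i == ib k t).
Proof.
apply: (measurable_fun_bool true); rewrite setTI.
rewrite (_ : _ @^-1` _ = ib k @^-1` [set i]); first exact: ib_meas.
by apply/seteqP; split=> t /=; [move=> /eqP ->|move=> ->; rewrite eqxx].
Qed.

Let index_mfun k i : {RV P >-> bool} := mfun_Sub (mem_set (index_measurable k i)).

Lemma index_indep k i A B : <<s history events (past k) >> A ->
  measurable B ->
  (P (A `&` index_mfun k i @^-1` B) = P A * P (index_mfun k i @^-1` B))%E.
Proof.
apply: (@source_indep _ (BlockIndex k)) => //=; first by rewrite ltnn.
by move=> _ [C mC <-]; exists [set j | C (i == j)].
Qed.

Lemma measurable_bounded_sqr (f : T -> R) : measurable_fun setT f ->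
  (\int[P]_t (`|f t| ^+ 2)%:E <= sigma2%:E)%E ->
  (\int[P]_t `|f t|%:E <= (1 + sigma2)%:E)%E.
Proof.
move=> mf fs.
have mn : measurable_fun setT (fun t => `|f t|).
  exact: (measurableT_comp (@normr_measurable _ _) mf).
apply: (@le_trans _ _ (\int[P]_t (cst 1%:E t + (`|f t| ^+ 2)%:E))%E).
  apply: ge0_le_integral => //.
  - exact/measurable_EFinP.
  - apply: emeasurable_funD => //; apply/measurable_EFinP.
    exact: measurable_funX.
  - move=> t _ /=; rewrite -EFinD lee_fin.
    by have := sqr_ge0 (`|f t| - 1 / 2); lra.
rewrite ge0_integralD //; last by apply/measurable_EFinP; exact: measurable_funX.
by rewrite EFinD leeD // integral_probability_cst.
Qed.

Let oracle_measurable_point (z : 'rV[R]_N) (v : {RV P >-> borelV R m0}) :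
  BX z -> measurable_fun setT ((fun t => Fs z (v t)) : T -> borelV R N).
Proof.
move=> Xz; apply: (@measurable_oracle _ _ (cst z) v) => //.
Qed.

Let oracle_coord_measurable s :
  measurable_fun ((BX : set (borelV R N)) `*` [set: borelV R m0])
    (fun z : borelV R N * borelV R m0 => (Fs z.1 z.2) 0 s).
Proof. exact: (measurableT_comp (measurable_coord s) Fs_meas). Qed.

Let F_coord_cont s : {within BX, continuous (fun z => F z 0 s)}.
Proof.
apply/subspace_continuousP => z Xz; apply: cvg_coord.
by move/subspace_continuousP: F_cont; apply.
Qed.

Let error_measurable s :
  measurable_fun ((BX : set (borelV R N)) `*` [set: borelV R m0])
    (fun z : borelV R N * borelV R m0 => Fs z.1 z.2 0 s - F z.1 0 s).
Proof.
apply: measurable_funB; first exact: oracle_coord_measurable.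
apply: (@measurable_comp _ _ _ _ _ _ (BX : set (borelV R N))
  (fun z : borelV R N => F z 0 s) _ (fst : borelV R N * borelV R m0 -> _)).
- exact: measurable_closed_borelV.
- by move=> _ [z [Xz _] <-].
- exact: continuous_borelV_real BX_closed (@F_coord_cont s).
- exact: measurable_funTS measurable_fst.
Qed.

Let coord_abs_integral k z s : BX z ->
  (\int[P]_t `|Fs z (xis k t) 0 s|%:E <= (1 + sigma2)%:E)%E.
Proof.
move=> Xz; have mo := oracle_measurable_point (xis k) Xz.
have ms : measurable_fun setT (fun t => Fs z (xis k t) 0 s).
  exact: (measurableT_comp (measurable_coord s) mo).
apply: measurable_bounded_sqr => //.
apply: le_trans (oracle_sqr k Xz); apply: ge0_le_integral => //.
- apply/measurable_EFinP; apply: measurable_funX.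
  exact: (measurableT_comp (@normr_measurable _ _) ms).
- apply/measurable_EFinP; apply: measurable_funX.
  have nc : measurable_fun setT (fun v : borelV R N => `|v : 'rV[R]_N|).
    apply: continuous_borelV_real; first exact: closedT.
    by apply: continuous_subspaceT; exact: norm_continuous.
  exact: (measurableT_comp nc mo).
- by move=> t _; rewrite lee_fin lerXn2r ?nnegrE // ler_coord_norm.
Qed.

Lemma oracle_error_mean k z s : BX z ->
  (\int[P]_t (Fs z (xis k t) 0 s - F z 0 s)%:E = 0)%E.
Proof.
move=> Xz; have mo := oracle_measurable_point (xis k) Xz.
have int : P.-integrable setT (fun t => (Fs z (xis k t) 0 s)%:E).
  apply/integrableP; split.
    by apply/measurable_EFinP; exact: (measurableT_comp (measurable_coord s) mo).
  by apply: le_lt_trans (coord_abs_integral k s Xz) _; exact: ltry.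
under eq_integral do rewrite EFinB.
rewrite integralB //; last exact: finite_measure_integrable_cst.
rewrite oracle_mean // -[X in (_ - X)%E]/(\int[P]_t (cst (F z 0 s)%:E t))%E.
by rewrite integral_probability_cst subee.
Qed.

(** The bound is uniform in the point, as required for integrating the error at the random point
    [y k.+1]. *)
Lemma oracle_error_abs : exists c, forall k z s, BX z ->
  (\int[P]_t `|Fs z (xis k t) 0 s - F z 0 s|%:E <= c%:E)%E.
Proof.
have [K K0 hK] := iterate_bound.
exists (1 + sigma2 + K) => k z s Xz; have [_ _ FK] := hK _ Xz.
have mo := oracle_measurable_point (xis k) Xz.
have ms : measurable_fun setT (fun t => Fs z (xis k t) 0 s).
  exact: (measurableT_comp (measurable_coord s) mo).
have mn : measurable_fun setT (fun t => `|Fs z (xis k t) 0 s|).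
  exact: (measurableT_comp (@normr_measurable _ _) ms).
apply: (@le_trans _ _ (\int[P]_t (`|Fs z (xis k t) 0 s|%:E + cst K%:E t))%E).
  apply: ge0_le_integral => //.
  - apply/measurable_EFinP; apply: (measurableT_comp (@normr_measurable _ _)).
    exact: measurable_funB.
  - by apply: emeasurable_funD => //; exact/measurable_EFinP.
  - move=> t _ /=; rewrite -EFinD lee_fin.
    apply: le_trans (ler_normB _ _) _; rewrite lerD2l.
    exact: le_trans (ler_coord_norm _ _) FK.
rewrite ge0_integralD //; last exact/measurable_EFinP.
by rewrite EFinD leeD ?coord_abs_integral // integral_probability_cst.
Qed.

Let block_gap_cont i : {within BX, continuous (block_gap i)}.
Proof.
apply/subspace_continuousP => z Xz; apply: cvg_dotv.
  have Fz : F u @[u --> within BX (nbhs z)] --> F z.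
    by move/subspace_continuousP: F_cont; apply.
  by apply: cvg_comp Fz _; exact: submxrow_continuous.
apply: cvgB; last exact: cvg_cst.
by apply: cvg_within_filter; exact: submxrow_continuous.
Qed.

(** The centred indicator is independent of [past k], and the block gap at [x k] is a bounded weight
    measurable for that history. *)
Lemma index_zero_mean k i A : <<s history events (past k) >> A ->
  zero_mean P A (fun t => block_gap i (x k t) * ((i == ib k t)%:R / p i - 1)).
Proof.
move=> HA.
have [K K0 gK] : exists2 K, 0 <= K & forall z, BX z -> `|block_gap i z| <= K.
  apply: within_bounded; apply/subspace_continuousP => z Xz.
  by apply: cvg_norm; move/subspace_continuousP: (@block_gap_cont i); apply.
have mi := @index_measurable k i.
have mind : measurable_fun setT (fun t => (i == ib k t)%:R / p i : R).
  apply: measurable_funM => //.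
  by apply: (measurableT_comp (f := fun b : bool => b%:R : R) _ mi).
have index_int : P.-integrable setT (fun t => ((i == ib k t)%:R / p i)%:E).
  apply: (bounded_integrable P (K := (p i)^-1)) => // t.
  by case: (i == _); rewrite ?mul1r ?mul0r invr_ge0 ?lexx ?andbT ltW.
have iE : (\int[P]_t ((i == ib k t)%:R / p i)%:E = 1)%E.
  under eq_integral do rewrite EFinM muleC.
  rewrite ge0_integralZl_EFin //; last 2 first.
  - apply/measurable_EFinP.
    by apply: (measurableT_comp (f := fun b : bool => b%:R : R) _ mi).
  - by rewrite invr_ge0 ltW.
  have -> : (\int[P]_t (i == ib k t)%:R%:E = \int[P]_t (\1_(ib k @^-1` [set i]) t)%:E)%E.
    apply: eq_integral => t _; rewrite indicE; congr ((nat_of_bool _)%:R%:E).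
    by apply/eqP/idP => [->|]; rewrite inE.
  rewrite integral_indic // setIT [X in (_ * X)%E](_ : _ = (p i)%:E); last exact: block_prob.
  by rewrite -EFinM mulVf // gt_eqF.
apply: (@indep_zero_mean _ _ _ P _ (@history_events_measurable (past k)) _ _
  (index_mfun k i) (@index_indep k i) _ (borelV R N) BX (x k)
  (measurable_closed_borelV BX_closed) (@iterate_in k) (@measurable_iterate k)
  A (fun t => block_gap i (x k t)) K (fun z => (z.2)%:R / p i - 1) ((p i)^-1 + 1)) => //.
- exact: (@measurable_within _ (TH (past k)) _ _ (@block_gap_cont i)
    (@iterate_in k) (@measurable_iterate k)).
- by move=> t; apply: gK; exact: iterate_in.
- apply: measurable_funTS.
  apply: (measurableT_comp (f := fun b : bool => b%:R / p i - 1 : R)) => //.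
- move=> u _ /=; under eq_integral do rewrite EFinB.
  rewrite integralB //; last exact: finite_measure_integrable_cst.
  by rewrite iE -[X in (_ - X)%E]/(\int[P]_t (cst 1%:E t))%E
    integral_probability_cst subee.
- move=> u _ /=.
  apply: (@le_trans _ _ (\int[P]_t (cst ((p i)^-1 + 1)%:E t))%E).
    apply: ge0_le_integral => //.
    + apply/measurable_EFinP; apply: (measurableT_comp (@normr_measurable _ _)).
      exact: measurable_funB.
    + move=> t _ /=; rewrite lee_fin (le_trans (ler_normB _ _)) // normr1 lerD2r.
      rewrite normrM normr_nat ger0_norm ?invr_ge0 ?(ltW (p_gt0 i)) //.
      by case: (i == _); rewrite ?mul1r // mul0r invr_ge0 ltW.
  by rewrite integral_probability_cst.
Qed.

(** The first factor, which involves the drawn index, is measurable for [past_extrapolation k] and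
    bounded by the diameter over [p i]; the second is the error of a fresh sample at a point of that
    history. *)
Lemma oracle_zero_mean k i l A : <<s history events (past k) >> A ->
  zero_mean P A (fun t =>
    ((i == ib k t)%:R / p i * (submxrow (x k t) i 0 l - submxrow xs i 0 l)) *
    (submxrow (Fs (y k.+1 t) (xis k t)) i 0 l - submxrow (F (y k.+1 t)) i 0 l)).
Proof.
move=> HA.
have HA' : <<s history events (past_extrapolation k) >> A.
  exact: history_sub (@past_extrapolation_sub k) _ HA.
have [c hc] := oracle_error_abs.
have mx := measurable_history_sub (@past_extrapolation_sub k) (@measurable_iterate k).
have pos : 0 < (p i)^-1 by rewrite invr_gt0.
under [X in zero_mean _ _ X]funext => t.
  rewrite [submxrow (Fs _ _) i 0 l]mxE [submxrow (F _) i 0 l]mxE; over.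
apply: (@indep_zero_mean _ _ _ P _ (@history_events_measurable (past_extrapolation k)) _ _
  (xis k) (@sample_indep k) _ (borelV R N) BX (y k.+1)
  (measurable_closed_borelV BX_closed) (@extrapolation_in k)
  (measurable_extrapolation (@measurable_iterate k))
  A (fun t => (i == ib k t)%:R / p i * (submxrow (x k t) i 0 l - submxrow xs i 0 l))
  ((p i)^-1 * D) (fun z => Fs z.1 z.2 0 (tagnat.Rank i l) - F z.1 0 (tagnat.Rank i l)) c) => //.
- apply: measurable_funM.
    apply: measurable_funM => //.
    apply: (measurableT_comp (f := fun b : bool => b%:R : R)) => //.
    by apply: measurable_history_index; right.
  apply: measurable_funB => //.
  have mxi := measurable_submxrow (i := i) mx.
  exact: (measurableT_comp (measurable_coord l) mxi).
- move=> t; rewrite normrM ler_pM //.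
    rewrite normrM normr_nat (gtr0_norm pos).
    by case: (i == _); rewrite ?mul1r // mul0r ltW.
  apply: le_trans (X_diam (iterate_in k t i) (BXxs i)).
  rewrite (_ : _ - _ = (submxrow (x k t) i - submxrow xs i) 0 l); last by rewrite !mxE.
  exact: ler_coord_norm.
- by move=> u Xu; exact: oracle_error_mean.
- by move=> u Xu; exact: hc.
Qed.

Let rate := \sum_i descent_rate i.

(** The drawn block terms of [block_descent] minus the full gap. Writing them as sums over all
    blocks with an indicator makes every summand a term with fixed [i], to which the two lemmas
    above apply. *)
Let noise k t : R :=
  \sum_i block_gap i (x k t) * ((i == ib k t)%:R / p i - 1) +
  \sum_i \sum_l
    ((i == ib k t)%:R / p i * (submxrow (x k t) i 0 l - submxrow xs i 0 l)) *
    (submxrow (Fs (y k.+1 t) (xis k t)) i 0 l - submxrow (F (y k.+1 t)) i 0 l).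

Let noise_zero_mean k A : <<s history events (past k) >> A ->
  zero_mean P A (noise k).
Proof.
move=> HA; have mA := history_events_measurable HA.
apply: zero_meanD => //.
  by apply: zero_mean_sum => // i; exact: index_zero_mean.
apply: zero_mean_sum => // i; apply: zero_mean_sum => // l.
exact: oracle_zero_mean.
Qed.

Let energy k t : R :=
  1 + `|Fs (x k t) (xits k t)| ^+ 2 + `|Fs (y k.+1 t) (xis k t)| ^+ 2.

(** [block_descent] for the drawn block, with its rate replaced by the sum of all rates, which is
    not random. *)
Lemma pathwise_descent k t :
  lyapunov (x k.+1 t) + gamma k * dotv (F (x k t)) (x k t - xs) <=
  lyapunov (x k t) + gamma k ^+ 2 * (rate * energy k t) + (- gamma k) * noise k t.
Proof.
set i := ib k t.
have Ey j : submxrow (y k.+1 t) j = if j == i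
    then prox (X j) (w j) (g j) (submxrow (x k t) j)
      (gamma k *: submxrow (Fs (x k t) (xits k t)) j)
    else submxrow (x k t) j by have [] := xy_BSMP.2 k t j.
have Ex j : submxrow (x k.+1 t) j = if j == i
    then prox (X j) (w j) (g j) (submxrow (x k t) j)
      (gamma k *: submxrow (Fs (y k.+1 t) (xis k t)) j)
    else submxrow (x k t) j by have [] := xy_BSMP.2 k t j.
have := block_descent (gamma_gt0 k) (iterate_in k t) Ey Ex.
have -> : noise k t = (p i)^-1 * block_gap i (x k t)
     - dotv (F (x k t)) (x k t - xs)
     + (p i)^-1 * dotv (submxrow (Fs (y k.+1 t) (xis k t)) i - submxrow (F (y k.+1 t)) i)
         (submxrow (x k t) i - submxrow xs i).
  rewrite /noise -sum_block_gap; congr (_ + _).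
    under eq_bigr do rewrite mulrBr mulr1.
    rewrite sumrB (bigD1 i) //= eqxx mul1r big1 ?addr0; first by rewrite mulrC.
    by move=> j /negPf ji; rewrite ji mul0r mulr0.
  rewrite (bigD1 i) //= [X in _ + X = _]big1 ?addr0; last first.
    by move=> j /negPf ji; rewrite big1 // => l _; rewrite ji !mul0r.
  rewrite mulr_sumr; apply: eq_bigr => l _.
  by rewrite eqxx mul1r !mxE; ring.
have : gamma k ^+ 2 * (descent_rate i * energy k t) <=
       gamma k ^+ 2 * (rate * energy k t).
  rewrite ler_wpM2l ?sqr_ge0 // ler_wpM2r //.
    by rewrite !addr_ge0 ?sqr_ge0.
  rewrite /rate (bigD1 i) //= lerDl sumr_ge0 // => j _.
  exact: descent_rate_ge0.
rewrite -/(energy k t); lra.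
Qed.

Let rate_ge0 : 0 <= rate.
Proof. by apply: sumr_ge0 => i _; exact: descent_rate_ge0. Qed.

Let sigma2_ge0 : 0 <= sigma2.
Proof.
rewrite -lee_fin; apply: le_trans (oracle_sqr 0%N BXxs).
by apply: integral_ge0 => t _; rewrite lee_fin.
Qed.

Let norm_oracle_measurable : measurable_fun
  ((BX : set (borelV R N)) `*` [set: borelV R m0])
  (fun z : borelV R N * borelV R m0 => `|Fs z.1 z.2| ^+ 2).
Proof.
have nc : measurable_fun setT (fun v : borelV R N => `|v : 'rV[R]_N| ^+ 2).
  apply: measurable_funX.
  apply: continuous_borelV_real; first exact: closedT.
  by apply: continuous_subspaceT; exact: norm_continuous.
exact: (measurableT_comp nc Fs_meas).
Qed.

Let extrapolation_energy k :
  (\int[P]_t (`|Fs (x k t) (xits k t)| ^+ 2)%:E <= sigma2%:E)%E.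
Proof.
apply: (@indep_bound _ _ _ P _ (@history_events_measurable (past k)) _ _
  (xits k) (@sample_extrapolation_indep k) _ (borelV R N) BX (x k)
  (measurable_closed_borelV BX_closed) (@iterate_in k) (@measurable_iterate k)
  (fun z => `|Fs z.1 z.2| ^+ 2)) => //.
by move=> u Xu; exact: oracle_sqr_extrapolation.
Qed.

Let update_energy k :
  (\int[P]_t (`|Fs (y k.+1 t) (xis k t)| ^+ 2)%:E <= sigma2%:E)%E.
Proof.
apply: (@indep_bound _ _ _ P _ (@history_events_measurable (past_extrapolation k)) _ _
  (xis k) (@sample_indep k) _ (borelV R N) BX (y k.+1)
  (measurable_closed_borelV BX_closed) (@extrapolation_in k)
  (measurable_extrapolation (@measurable_iterate k))
  (fun z => `|Fs z.1 z.2| ^+ 2)) => //.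
by move=> u Xu; exact: oracle_sqr.
Qed.

Let history_T S dU (U : measurableType dU) (f : T -> U) :
  measurable_fun setT (f : TH S -> U) -> measurable_fun setT f.
Proof. by move=> mf _ B mB; apply: (@history_events_measurable S); exact: mf. Qed.

Let energy_measurable k : measurable_fun setT (energy k).
Proof.
apply: measurable_funD; first apply: measurable_funD => //.
- apply: (indep_measurable (@history_events_measurable (past k)) (xits k)
    (measurable_closed_borelV BX_closed)
    (@iterate_in k) (@measurable_iterate k) norm_oracle_measurable).
- apply: (indep_measurable (@history_events_measurable (past_extrapolation k)) (xis k)
    (measurable_closed_borelV BX_closed)
    (@extrapolation_in k) (measurable_extrapolation (@measurable_iterate k))
    norm_oracle_measurable).
Qed.

Let energy_ge0 k t : 0 <= energy k t.
Proof. by rewrite !addr_ge0 ?sqr_ge0. Qed.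

Let energy_mean k A : measurable A ->
  (\int[P]_(t in A) (energy k t)%:E <= (1 + sigma2 + sigma2)%:E)%E.
Proof.
move=> mA; apply: (@le_trans _ _ (\int[P]_t (energy k t)%:E)%E).
  apply: ge0_subset_integral => //; first exact/measurable_EFinP.
  by move=> t _; rewrite lee_fin.
rewrite -[leLHS]/(\int[P]_t (1 + `|Fs (x k t) (xits k t)| ^+ 2 +
  `|Fs (y k.+1 t) (xis k t)| ^+ 2)%:E)%E.
have m1 : measurable_fun setT (fun t => `|Fs (x k t) (xits k t)| ^+ 2).
  exact: (indep_measurable (@history_events_measurable (past k)) (xits k)
    (measurable_closed_borelV BX_closed)
    (@iterate_in k) (@measurable_iterate k) norm_oracle_measurable).
have m2 : measurable_fun setT (fun t => `|Fs (y k.+1 t) (xis k t)| ^+ 2).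
  exact: (indep_measurable (@history_events_measurable (past_extrapolation k)) (xis k)
    (measurable_closed_borelV BX_closed)
    (@extrapolation_in k) (measurable_extrapolation (@measurable_iterate k))
    norm_oracle_measurable).
under eq_integral do rewrite !EFinD.
rewrite ge0_integralD //; last 3 first.
- by move=> t _; rewrite -EFinD lee_fin addr_ge0 // sqr_ge0.
- by apply: emeasurable_funD => //; exact/measurable_EFinP.
- exact/measurable_EFinP.
rewrite ge0_integralD //; last exact/measurable_EFinP.
by rewrite !EFinD leeD // leeD // -[X in (X <= _)%E]/(\int[P]_t (cst 1%:E t))%E
  integral_probability_cst.
Qed.

Let lyapunov_measurable k : measurable_fun setT (fun t => lyapunov (x k t)).
Proof.
apply: (@history_T (past k)).
exact: (@measurable_within _ (TH (past k)) _ _ lyapunov_cont (@iterate_in k)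
  (@measurable_iterate k)).
Qed.

Let gap_measurable k :
  measurable_fun setT (fun t => dotv (F (x k t)) (x k t - xs)).
Proof.
apply: (@history_T (past k)).
exact: (@measurable_within _ (TH (past k)) _ _ gap_cont (@iterate_in k)
  (@measurable_iterate k)).
Qed.

Lemma mean_descent k A : <<s history events (past k) >> A ->
  (\int[P]_(t in A) (lyapunov (x k.+1 t))%:E +
     (gamma k)%:E * \int[P]_(t in A) (dotv (F (x k t)) (x k t - xs))%:E <=
   \int[P]_(t in A) (lyapunov (x k t))%:E +
     (rate * (1 + sigma2 + sigma2) * gamma k ^+ 2)%:E)%E.
Proof.
move=> HA; have mA := history_events_measurable HA.
have [K K0 hK] := iterate_bound.
have Vi l : P.-integrable A (fun t => (lyapunov (x l t))%:E).
  apply: (bounded_integrable P (K := K)) => // t.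
  by have [-> _ _] := hK _ (iterate_in l t); rewrite lyapunov_ge0 //; exact: iterate_in.
have Wi : P.-integrable A (fun t => (dotv (F (x k t)) (x k t - xs))%:E).
  apply: (bounded_integrable P (K := K)) => // t.
  by have [_ -> _] := hK _ (iterate_in k t); rewrite gap_ge0 //; exact: iterate_in.
have Ei : P.-integrable A (fun t => (energy k t)%:E).
  apply/integrableP; split; first exact/measurable_EFinP/measurable_funTS.
  under eq_integral do rewrite gee0_abs ?lee_fin ?energy_ge0 //.
  by apply: le_lt_trans (energy_mean k mA) _; exact: ltry.
have [Ni N0] := zero_meanZ (- gamma k) mA (noise_zero_mean HA).
have Ei' := integrableZl mA (gamma k ^+ 2 * rate) Ei.
have -> : ((gamma k)%:E * \int[P]_(t in A) (dotv (F (x k t)) (x k t - xs))%:E =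
   \int[P]_(t in A) ((gamma k)%:E * (dotv (F (x k t)) (x k t - xs))%:E))%E.
  by rewrite integralZl.
rewrite -integralD //; last exact: integrableZl.
apply: (@le_trans _ _ (\int[P]_(t in A) ((lyapunov (x k t))%:E +
   (gamma k ^+ 2 * rate)%:E * (energy k t)%:E + ((- gamma k) * noise k t)%:E))%E).
  apply: le_integral => //.
  - by apply: integrableD => //; exact: integrableZl.
  - by apply: integrableD => //; exact: integrableD.
  - move=> t _; rewrite -!EFinM -!EFinD lee_fin -mulrA.
    exact: pathwise_descent.
rewrite integralD //; last exact: integrableD.
rewrite N0 adde0 integralD // leeD // integralZl //.
apply: (@le_trans _ _ ((gamma k ^+ 2 * rate)%:E * (1 + sigma2 + sigma2)%:E)%E).
  apply: lee_pmul => //.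
  - by rewrite lee_fin mulr_ge0 ?sqr_ge0.
  - by apply: integral_ge0 => t _; rewrite lee_fin.
  - exact: energy_mean.
by rewrite -EFinM lee_fin; lra.
Qed.

(** * Almost sure convergence *)

Hypotheses (gamma_sqr : cvgn (series (fun k => gamma k ^+ 2)))
  (gamma_sum : series gamma @ \oo --> +oo).

Theorem iterate_cvg : {ae P, forall t, x k t @[k --> \oo] --> xs}.
Proof.
have [K K0 hK] := iterate_bound.
have : {ae P, forall t, lyapunov (x k t) @[k --> \oo] --> 0}.
  apply: (@almost_supermartingale_cvg0 _ _ _ P
    (fun k => <<s history events (past k) >>) _
    (fun k t => dotv (F (x k t)) (x k t - xs)) gamma
    (rate * (1 + sigma2 + sigma2)) K) => //.
  - by move=> k A; exact: history_events_measurable.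
  - by move=> k; exact: (@measurableT _ (TH (past k))).
  - by move=> k A B HA HB; exact: (@measurableI _ (TH (past k))).
  - move=> k; apply: history_sub.
    exact: subset_trans (@past_extrapolation_sub k) (@past_extrapolation_subS k).
  - move=> k a.
    have mV := @measurable_within _ (TH (past k)) _ _ lyapunov_cont
      (@iterate_in k) (@measurable_iterate k) measurableT _ (measurable_itv `]-oo, a[).
    rewrite setTI in mV.
    rewrite (_ : [set t | _ < a] = (fun t => lyapunov (x k t)) @^-1` `]-oo, a[).
      exact: mV.
    by apply/seteqP; split=> t; rewrite /= in_itv.
  - by move=> k t; apply: lyapunov_ge0; exact: iterate_in.
  - by move=> k t; have [] := hK _ (iterate_in k t).
  - by move=> k t; apply: gap_ge0; exact: iterate_in.
  - by move=> k t; have [] := hK _ (iterate_in k t).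
  - move=> e e0; have [c c0 hc] := lyapunov_le_gap e0.
    by exists c => // k t; apply: hc; exact: iterate_in.
  - by rewrite mulr_ge0 // !addr_ge0.
  - exact: mean_descent.
apply: filterS => t Vt; apply/cvgrPdist_le => e e0.
have [delta d0 hd] := lyapunov_small e0.
move/cvgrPdist_lt : Vt => /(_ _ d0); apply: filterS => k.
rewrite sub0r normrN ger0_norm ?lyapunov_ge0 //; last exact: iterate_in.
by rewrite distrC => /hd; apply; exact: iterate_in.
Qed.

End descent.

(** * Reduction to the sup norm *)

(** Meant for [N] the dual norms, [h] an oracle value and [a] its mean: the square of the norm of
    [h] is at most twice that of [h - a] plus twice that of [a], and the former is split over the
    blocks. *)
Lemma second_moment_le (R : realType) (d : nat) (n : 'I_d -> nat)
    (dT : measure_display) (T : measurableType dT) (P : probability T R)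
    (N : forall i, 'rV[R]_(n i) -> R) (K nu : 'I_d -> R)
    (h : T -> 'rV[R]_(\sum_(i < d) n i)) (a : 'rV[R]_(\sum_(i < d) n i)) :
  (forall i, 0 < K i) -> (forall i, continuous (N i)) ->
  (forall i u, `|u| <= K i * N i u) ->
  measurable_fun setT (h : T -> borelV R _) ->
  (forall i, \int[P]_t (N i (submxrow (h t) i - submxrow a i) ^+ 2)%:E
             <= (nu i ^+ 2)%:E)%E ->
  (\int[P]_t (`|h t| ^+ 2)%:E <=
     (\sum_i 2 * K i ^+ 2 * nu i ^+ 2 + 2 * `|a| ^+ 2)%:E)%E.
Proof.
move=> K0 Nc KN mh hN.
pose q i t := N i (submxrow (h t) i - submxrow a i) ^+ 2.
have mq i : measurable_fun setT (q i).
  apply: measurable_funX.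
  have mN : measurable_fun setT (N i : borelV R (n i) -> R).
    apply: continuous_borelV_real; first exact: closedT.
    by apply: continuous_subspaceT; exact: Nc.
  have mb : measurable_fun setT
      ((fun t => submxrow (h t) i - submxrow a i) : T -> borelV R (n i)).
    apply: measurable_borelV => j; under eq_fun do rewrite !mxE.
    apply: measurable_funB => //.
    exact: (measurableT_comp (measurable_coord _) mh).
  exact: (measurableT_comp mN mb).
have pw t : `|h t| ^+ 2 <= \sum_i 2 * K i ^+ 2 * q i t + 2 * `|a| ^+ 2.
  pose S := \sum_i K i ^+ 2 * q i t.
  have q0 i : 0 <= K i ^+ 2 * q i t by rewrite mulr_ge0 // sqr_ge0.
  have S0 : 0 <= S by exact: sumr_ge0.
  have haS : `|h t - a| ^+ 2 <= S.
    rewrite -[leRHS]sqr_sqrtr // lerXn2r ?nnegrE ?sqrtr_ge0 //.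
    apply: ler_norm_blocks => [|i]; first exact: sqrtr_ge0.
    rewrite -ler_sqr ?nnegrE ?sqrtr_ge0 // sqr_sqrtr // submxrowB.
    apply: (@le_trans _ _ (K i ^+ 2 * q i t)).
      have h1 := KN i (submxrow (h t) i - submxrow a i).
      rewrite /q -exprMn lerXn2r ?nnegrE //.
      exact: le_trans h1.
    by rewrite /S (bigD1 i) //= lerDl sumr_ge0.
  have -> : \sum_i 2 * K i ^+ 2 * q i t = 2 * S.
    by rewrite mulr_sumr; apply: eq_bigr => i _; rewrite mulrA.
  have hh : `|h t| ^+ 2 <= (`|h t - a| + `|a|) ^+ 2.
    rewrite lerXn2r ?nnegrE ?addr_ge0 //.
    by rewrite -{1}(subrK a (h t)) ler_normD.
  apply: le_trans hh _; have := sqr_ge0 (`|h t - a| - `|a|); lra.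
apply: (@le_trans _ _ (\int[P]_t (\sum_i (2 * K i ^+ 2 * q i t)%:E + cst (2 * `|a| ^+ 2)%:E t))%E).
  have nc : measurable_fun setT (fun v : borelV R (\sum_i n i) => `|v : 'rV[R]_(\sum_i n i)| ^+ 2).
    apply: measurable_funX; apply: continuous_borelV_real; first exact: closedT.
    by apply: continuous_subspaceT; exact: norm_continuous.
  apply: ge0_le_integral => //.
  - exact/measurable_EFinP/(measurableT_comp nc mh).
  - apply: emeasurable_funD => //; apply: emeasurable_sum => i.
    by apply/measurable_EFinP; exact: measurable_funM.
  - by move=> t _ /=; rewrite sumEFin -EFinD lee_fin.
have q0 i t : (0 <= (2 * K i ^+ 2 * q i t)%:E)%E.
  by rewrite lee_fin mulr_ge0 ?sqr_ge0 // mulr_ge0 // sqr_ge0.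
have mKq i : measurable_fun setT (fun t => (2 * K i ^+ 2 * q i t)%:E).
  by apply/measurable_EFinP; exact: measurable_funM.
rewrite ge0_integralD //; last 3 first.
- by move=> t _; exact: sume_ge0.
- exact: emeasurable_sum.
- by move=> t _; rewrite lee_fin mulr_ge0 // sqr_ge0.
rewrite EFinD leeD //; last first.
  by rewrite integral_probability_cst.
rewrite ge0_integral_sum // -sumEFin; apply: lee_sum => i _.
under eq_integral do rewrite EFinM.
rewrite ge0_integralZl_EFin //; last 3 first.
- by move=> t _; rewrite lee_fin sqr_ge0.
- exact/measurable_EFinP.
- by rewrite mulr_ge0 // sqr_ge0.
rewrite [leRHS]EFinM lee_pmul2l ?fin_numE // ?lte_fin ?mulr_gt0 ?exprn_gt0 //.
exact: hN.
Qed.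

Lemma C1_on_within_continuous (R : realType) (k : nat) (A : set 'rV[R]_k)
    (f : 'rV[R]_k -> R) (g : 'rV[R]_k -> 'rV[R]_k) :
  C1_on A f g -> {within A, continuous f}.
Proof.
move=> [_ df]; apply/subspace_continuousP => u Au; apply/cvgrPdist_le => e e0.
have c0 : 0 < k%:R * `|g u| + 1 by rewrite ltr_wpDl // mulr_ge0.
(* The first-order expansion with error constant 1 gives the local Lipschitz constant
   [k%:R * |g u| + 1]. *)
have near_u : \forall v \near within A (nbhs u), `|u - v| <= e / (k%:R * `|g u| + 1).
  apply: (@cvgr_dist_le _ _ _ (within A (nbhs u)) _ id) => //; last by rewrite divr_gt0.
  exact: cvg_within_filter.
apply: filterS2 (df u Au 1 ltr01) near_u => v; rewrite mul1r => fv uv.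
rewrite distrC -(subrK (dotv (g u) (v - u)) (f v - f u)).
apply: le_trans (ler_normD _ _) _.
apply: le_trans (lerD fv (ler_norm_dotv _ _)) _.
rewrite -[X in X + _]mul1r -mulrDl distrC addrC.
by rewrite -ler_pdivlMl // mulrC.
Qed.

Theorem proposition1 (R : realType)
  (d : nat) (n : 'I_d -> nat) (m : nat)
  (d_ge1 : (1 <= d)%N) (n_ge1 : forall i, (1 <= n i)%N)
  (* norms and feasible sets *)
  (nrm : forall i, 'rV[R]_(n i) -> R) (nrmP : forall i, is_norm (nrm i))
  (X : forall i, set 'rV[R]_(n i))
  (* probability space, random vector xi, random mapping and its mean *)
  (dT : measure_display) (T : measurableType dT) (P : probability T R)
  (xi : {RV P >-> borelV R m})
  (Fs : 'rV[R]_(\sum_(i < d) n i) -> 'rV[R]_m -> 'rV[R]_(\sum_(i < d) n i))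
  (Fs_meas : measurable_fun ((block_prod X : set (borelV R (\sum_(i < d) n i)))
       `*` [set: borelV R m])
     (fun z : borelV R (\sum_(i < d) n i) * borelV R m =>
        (Fs z.1 z.2 : borelV R (\sum_(i < d) n i))))
  (F : 'rV[R]_(\sum_(i < d) n i) -> 'rV[R]_(\sum_(i < d) n i))
  (F_fin : forall z j, block_prod X z ->
     P.-integrable [set: T] (fun t => (Fs z (xi t) 0 j)%:E))
  (F_mean : forall z j, block_prod X z ->
     ('E_P[(fun t => Fs z (xi t) 0 j)%R] = (F z 0 j)%:E)%E)
  (* F continuous: not a consequence of P2, and the result fails without it *)
  (F_cont : {within block_prod X, continuous F})
  (* distance-generating functions *)
  (omega : forall i, 'rV[R]_(n i) -> R)
  (gomega : forall i, 'rV[R]_(n i) -> 'rV[R]_(n i))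
  (mu Lomega : 'I_d -> R)
  (omega_C1 : forall i, C1_on (X i) (omega i) (gomega i))
  (mu_gt0 : forall i, 0 < mu i)
  (omega_sconvex : forall i u v, X i u -> X i v ->
     omega i u + dotv (gomega i u) (v - u) + mu i / 2 * nrm i (u - v) ^+ 2
       <= omega i v)
  (omega_smooth : forall i u v, X i u -> X i v ->
     omega i v
       <= omega i u + dotv (gomega i u) (v - u)
          + Lomega i / 2 * nrm i (u - v) ^+ 2)
  (* problem assumptions *)
  (B L : 'I_d -> R)
  (P1 : forall i, [/\ X i !=set0, closed (X i), convex_set (X i) &
                      forall u, X i u -> nrm i u <= B i])
  (P2 : forall i x y, block_prod X x -> block_prod X y ->
     (forall j, j != i -> submxrow x j = submxrow y j) ->
     dual_norm (nrm i) (submxrow (F x) i - submxrow (F y) i)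
       <= L i * nrm i (submxrow x i - submxrow y i))
  (* the algorithm *)
  (p : 'I_d -> R) (p_sum : \sum_(i < d) p i = 1)
  (gamma : nat -> R)
  (xis xits : nat -> {RV P >-> borelV R m})
  (xis_law : forall k A, measurable A ->
     distribution P (xis k) A = distribution P xi A)
  (xits_law : forall k A, measurable A ->
     distribution P (xits k) A = distribution P xi A)
  (ib : nat -> T -> 'I_d)
  (ib_meas : forall k i, measurable (ib k @^-1` [set i]))
  (x y : nat -> T -> 'rV[R]_(\sum_(i < d) n i))
  (x0_meas : measurable_fun [set: T]
     (x 0%N : T -> borelV R (\sum_(i < d) n i)))
  (xy_BSMP : BSMP X omega gomega Fs gamma (fun k => xis k) (fun k => xits k)
               ib x y)
  (* sampling assumptions *)
  (R1 : mutually_independent P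
     (source_events (x 0%N) (fun k => xis k) (fun k => xits k) ib))
  (R2 : forall k z j, block_prod X z ->
     ('E_P[(fun t => Fs z (xits k t) 0 j)%R] = (F z 0 j)%:E)%E /\
     ('E_P[(fun t => Fs z (xis k t) 0 j)%R] = (F z 0 j)%:E)%E)
  (nu nut : 'I_d -> R) (nu_gt0 : forall i, 0 < nu i /\ 0 < nut i)
  (R3 : forall i k z, block_prod X z ->
     ('E_P[(fun t => dual_norm (nrm i)
             (submxrow (Fs z (xits k t)) i - submxrow (F z) i) ^+ 2)%R]
        <= (nut i ^+ 2)%:E)%E /\
     ('E_P[(fun t => dual_norm (nrm i)
             (submxrow (Fs z (xis k t)) i - submxrow (F z) i) ^+ 2)%R]
        <= (nu i ^+ 2)%:E)%E)
  (R4 : forall i k, P (ib k @^-1` [set i]) = (p i)%:E /\ 0 < p i)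
  (* stepsize assumptions *)
  (G1 : (forall k, 0 < gamma k) /\ cvgn (series (fun k => gamma k ^+ 2)))
  (G2 : series gamma @ \oo --> +oo)
  (F_pseudo : strictly_pseudomonotone (block_prod X) F) :
  exists2 xstar, unique (VI_solution (block_prod X) F) xstar &
    {ae P, forall t, x k t @[k --> \oo] --> xstar}.
Proof.
have [K KP] : {K : 'I_d -> R | forall i, 0 < K i /\
    forall u, [/\ nrm i u <= K i * `|u|, `|u| <= K i * nrm i u,
      dual_norm (nrm i) u <= K i * `|u| & `|u| <= K i * dual_norm (nrm i) u]}.
  pose Ki i := cid2 (norm_equivalence (nrmP i)).
  by exists (fun i => s2val (Ki i)) => i; split; [exact: s2valP (Ki i)|exact: s2valP' (Ki i)].
have K0 i : 0 < K i by have [] := KP i.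
have nrm_le i u : nrm i u <= K i * `|u| by have [_ /(_ u)[]] := KP i.
have le_nrm i u : `|u| <= K i * nrm i u by have [_ /(_ u)[]] := KP i.
have le_dual i u : `|u| <= K i * dual_norm (nrm i) u by have [_ /(_ u)[]] := KP i.
have nrm_ge0 i u : 0 <= nrm i u.
  by have := le_trans (normr_ge0 u) (le_nrm i u); rewrite pmulr_rge0.
have X0 i : X i !=set0 by have [] := P1 i.
have X_cvx i : segment_closed (X i).
  by apply: convex_segment_closed; have [] := P1 i.
have X_bnd i u : X i u -> `|u| <= K i * `|B i|.
  move=> Xu; apply: le_trans (le_nrm i u) _; rewrite ler_wpM2l ?(ltW (K0 i)) //.
  by apply: le_trans (ler_norm _); have [_ _ _] := P1 i; apply.
have X_cpt i : compact (X i).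
  apply: bounded_closed_compact; last by have [] := P1 i.
  exists (K i * `|B i|); split; first by rewrite num_real.
  by move=> M' /ltW KM u /X_bnd /le_trans; apply.
pose D := \sum_i (K i * `|B i| + K i * `|B i|).
have X_diam i u v : X i u -> X i v -> `|u - v| <= D.
  move=> Xu Xv; apply: le_trans (ler_normB _ _) _.
  apply: le_trans (lerD (X_bnd _ _ Xu) (X_bnd _ _ Xv)) _.
  rewrite /D (bigD1 i) //= lerDl sumr_ge0 // => j _.
  by rewrite addr_ge0 // mulr_ge0 // ltW.
pose ms i := mu i / K i ^+ 2.
have ms0 i : 0 < ms i by rewrite divr_gt0 // exprn_gt0.
(* The sign of [Lomega i] is not prescribed; likewise for [L i] in [Ls] below. *)
pose Ms i := Num.max (Lomega i) 0 * K i ^+ 2.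
have Ms0 i : 0 <= Ms i by rewrite mulr_ge0 ?sqr_ge0 // le_max lexx orbT.
have w_cont i : {within X i, continuous (omega i)}.
  exact: C1_on_within_continuous (omega_C1 i).
have g_cont i : {within X i, continuous (gomega i)} by have [] := omega_C1 i.
have w_ge i u v : X i u -> X i v ->
    ms i / 2 * `|u - v| ^+ 2 <= bregman (omega i) (gomega i) u v.
  move=> Xu Xv; have := omega_sconvex i u v Xu Xv; rewrite /bregman => h.
  have : `|u - v| ^+ 2 <= K i ^+ 2 * nrm i (u - v) ^+ 2.
    by rewrite -exprMn lerXn2r ?nnegrE ?mulr_ge0 // ltW.
  rewrite -ler_pdivrMl ?exprn_gt0 // => h1.
  have := ler_wpM2l (ltW (mu_gt0 i)) h1; rewrite /ms; lra.
have w_le i u v : X i u -> X i v ->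
    bregman (omega i) (gomega i) u v <= Ms i / 2 * `|u - v| ^+ 2.
  move=> Xu Xv; have := omega_smooth i u v Xu Xv; rewrite /bregman => h.
  have h1 : nrm i (u - v) ^+ 2 <= K i ^+ 2 * `|u - v| ^+ 2.
    by rewrite -exprMn lerXn2r ?nnegrE ?mulr_ge0 // ltW.
  have h2 : Lomega i * nrm i (u - v) ^+ 2 <= Ms i * `|u - v| ^+ 2.
    rewrite /Ms -mulrA; apply: (@le_trans _ _ (Num.max (Lomega i) 0 * nrm i (u - v) ^+ 2)).
      by rewrite ler_wpM2r ?sqr_ge0 // le_max lexx.
    by rewrite ler_wpM2l // le_max lexx orbT.
  lra.
(* One factor [K i] leaves the dual norm on the left of P2, the other leaves the norm on its
   right. *)
pose Ls i := K i * Num.max (L i) 0 * K i.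
have Ls0 i : 0 <= Ls i.
  by rewrite !mulr_ge0 ?(ltW (K0 i)) // le_max lexx orbT.
have F_lip i u v : block_prod X u -> block_prod X v ->
    (forall j, j != i -> submxrow u j = submxrow v j) ->
    `|submxrow (F u) i - submxrow (F v) i| <= Ls i * `|submxrow u i - submxrow v i|.
  move=> Xu Xv uv; apply: le_trans (le_dual _ _) _; rewrite /Ls -!mulrA.
  rewrite ler_wpM2l ?(ltW (K0 i)) //; apply: le_trans (P2 i u v Xu Xv uv) _.
  apply: (@le_trans _ _ (Num.max (L i) 0 * nrm i (submxrow u i - submxrow v i))).
    by rewrite ler_wpM2r // le_max lexx.
  by rewrite ler_wpM2l // le_max lexx orbT.
have BX_cpt := block_prod_compact X_cpt.
have BX0 := block_prod_nonempty X0.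
have [xs xs_unique] := VI_solution_unique (block_prod_segment_closed X_cvx)
  BX_cpt F_pseudo BX0 F_cont.
have xs_VI : VI_solution (block_prod X) F xs by case: xs_unique.
have Xxs : block_prod X xs by case: xs_VI.
exists xs => //.
have [b b0 Fb] : exists2 b, 0 <= b & forall z, block_prod X z -> `|F z| <= b.
  apply: (within_bounded X_cpt Xxs); apply/subspace_continuousP => z Xz.
  by apply: cvg_norm; move/subspace_continuousP: F_cont; apply.
(* [nu i + nut i] dominates both deviations, so one constant serves for both oracle calls; [b]
   bounds the mean. *)
pose s2 := \sum_i 2 * K i ^+ 2 * (nu i + nut i) ^+ 2 + 2 * b ^+ 2.
have second (v : {RV P >-> borelV R m}) (nu' : 'I_d -> R) z :
    (forall i, 0 <= nu' i <= nu i + nut i) -> block_prod X z ->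
    (forall i, \int[P]_t (dual_norm (nrm i)
       (submxrow (Fs z (v t)) i - submxrow (F z) i) ^+ 2)%:E <= (nu' i ^+ 2)%:E)%E ->
    (\int[P]_t (`|Fs z (v t)| ^+ 2)%:E <= s2%:E)%E.
  move=> nuP Xz h.
  have mv : measurable_fun setT ((fun t => Fs z (v t)) : T -> borelV R _).
    exact: (measurable_oracle X_cpt Fs_meas (z := cst z) (u := v) (fun=> Xz)).
  apply: le_trans (second_moment_le K0 (fun i => dual_norm_continuous (nrmP i))
    le_dual mv h) _.
  rewrite lee_fin /s2 lerD //.
    apply: ler_sum => i _; have /andP[n0 n1] := nuP i.
    apply: ler_wpM2l; first by rewrite mulr_ge0 // sqr_ge0.
    by rewrite lerXn2r // nnegrE // (le_trans n0).
  by apply: ler_wpM2l => //; rewrite lerXn2r // ?nnegrE // Fb.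
have mean_int (f : T -> R) : ('E_P[f] = \int[P]_t (f t)%:E)%E by rewrite unlock.
apply: (iterate_cvg X0 X_cpt X_cvx ms0 w_cont w_ge w_le F_cont Ls0 F_lip
  (fun i => (R4 i 0%N).2) Xxs X_diam Ms0 F_pseudo xs_VI g_cont Fs_meas G1.1 ib_meas
  x0_meas xy_BSMP R1 (sigma2 := s2) _ _ _ _ G1.2 G2).
- by move=> k z s Xz; have [_] := R2 k z s Xz; rewrite mean_int.
- move=> k z Xz; apply: (second (xis k) nu) => // [i|i].
    by have [/ltW -> /ltW ?] := nu_gt0 i; rewrite lerDl.
  by have [_] := R3 i k z Xz; rewrite mean_int.
- move=> k z Xz; apply: (second (xits k) nut) => // [i|i].
    by have [/ltW ? /ltW ->] := nu_gt0 i; rewrite lerDr.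
  by have [+ _] := R3 i k z Xz; rewrite mean_int.
- by move=> i k; have [] := R4 i k.
Qed.
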